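(* Let $B$ be the spectral scale of $b_1,\dots,b_n$ relative to $\tau$. The following statements hold. (1) $F$ is an exposed face of $B$ if and only if there is a spectral pair $(s,\mathbf t)$ such that $F=\Psi([p_{s,\mathbf t}^-,p_{s,\mathbf t}^+])$. (2) If $\mathbf x$ is an extreme point of $B$, then $\mathbf x$ is an exposed point if and only if there is a spectral pair $(s,\mathbf t)$ such that $p_{s,\mathbf t}^-=p_{s,\mathbf t}^+$ and $\mathbf x=\Psi(p_{s,\mathbf t}^{\pm})$. (3) If $F$ is a face of $B$ that is not an extreme point, then $F$ is an exposed face if and only if there is a spectral pair $(s,\mathbf t)$ such that $F=\Psi([p_{s,\mathbf t}^-,p_{s,\mathbf t}^+])$ and $s$ is an eigenvalue of $b_{\mathbf t}$. Thus, in this case $p_{s,\mathbf t}^+-p_{s,\mathbf t}^-\neq 0$ and $b_{\mathbf t}(p_{s,\mathbf t}^+-p_{s,\mathbf t}^-)=s(p_{s,\mathbf t}^+-p_{s,\mathbf t}^-)$.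
   Context: $M$ is a finite von Neumann algebra with a faithful normal tracial state $\tau$, $n$ is a positive integer, and $b_1,\dots,b_n\in M$ are self-adjoint. $M_1^+=\{a\in M:0\le a\le 1\}$, $\Psi(a)=(\tau(a),\tau(b_1a),\dots,\tau(b_na))$, and $B=\Psi(M_1^+)\subset\mathbb R^{n+1}$ (the spectral scale of the $b_i$'s relative to $\tau$) is compact and convex. For projections $p\le q$ in $M$, $[p,q]=\{a\in M_1^+:p\le a\le q\}$. For nonzero $\mathbf t=(t_1,\dots,t_n)\in\mathbb R^n$, $b_{\mathbf t}=t_1b_1+\cdots+t_nb_n$. A spectral pair is a pair $(s,\mathbf t)$ with $s\in\mathbb R$ and $\mathbf t\in\mathbb R^n$ nonzero. For a spectral pair, $p_{s,\mathbf t}^+$ and $p_{s,\mathbf t}^-$ are the spectral projections of $b_{\mathbf t}$ for $(-\infty,s]$ and $(-\infty,s)$ respectively. A hyperplane of support for a convex set $C$ is a hyperplane meeting the boundary of $C$ and having $C$ in one of its closed half-spaces. A face $F$ of a convex set $C$ is exposed if $F=C\cap P$ (nonempty) for some hyperplane of support $P$ for $C$; an exposed face that is a single point is called an exposed point. *)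

(* Defs.v *)
From HB Require Import structures.
From mathcomp Require Import all_boot all_order all_algebra.
From mathcomp Require Import complex.
From mathcomp Require Import all_classical all_reals all_analysis.

Set Implicit Arguments.
Unset Strict Implicit.
Unset Printing Implicit Defensive.

Import Order.TTheory GRing.Theory Num.Theory.
Import numFieldNormedType.Exports.

Local Open Scope classical_set_scope.
Local Open Scope ring_scope.

(* A complex Hilbert space is a complete normed R[i]-module H together with a
   positive definite hermitian form dot (linear in its first argument) inducing
   the norm of H. *)
Definition hilbert_dot (R : realType) (H : completeNormedModType R[i])
    (dot : {dot H for Num.conj}) : Prop :=
  forall x : H, `|x| ^+ 2 = dot x x.

Section Operators.
Variables (R : realType) (H : completeNormedModType R[i]).
Variable dot : {dot H for Num.conj}.

Implicit Types (a c p q v : H -> H) (M S D : set (H -> H)).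

Definition bounded_op a : Prop := linear a /\ continuous a.

Definition is_adjoint a c : Prop := forall x y : H, dot (a x) y = dot x (c y).

Definition self_adjoint a : Prop := is_adjoint a a.

(* The order of R[i] is such that 0 <= z means that z is real and nonnegative. *)
Definition op_le a c : Prop := forall x : H, dot (a x) x <= dot (c x) x.

Definition is_projection p : Prop :=
  [/\ bounded_op p, self_adjoint p & p \o p = p].

Definition is_eigenvalue (s : R) a : Prop :=
  exists2 x : H, x != 0 & a x = s%:C%C *: x.

Definition commutant S : set (H -> H) :=
  [set a | bounded_op a /\ forall c, S c -> a \o c = c \o a].

Record von_neumann_algebra M : Prop := {
  vna_bounded : M `<=` bounded_op;
  vna_linear : forall (k : R[i]) a c, M a -> M c -> M (k *: a + c);
  vna_one : M idfun;
  vna_comp : forall a c, M a -> M c -> M (a \o c);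
  vna_adjoint : forall a, M a -> exists2 c, M c & is_adjoint a c;
  vna_bicommutant : commutant (commutant M) = M }.

Definition finite_vna M : Prop :=
  forall v w, M v -> M w -> is_adjoint v w -> w \o v = idfun -> v \o w = idfun.

Definition self_adjoint_part M : set (H -> H) :=
  [set a | M a /\ self_adjoint a].

Definition op_directed D : Prop :=
  D !=set0 /\
  forall a c, D a -> D c -> exists e, [/\ D e, op_le a e & op_le c e].

Definition is_op_lub M D a : Prop :=
  [/\ self_adjoint_part M a,
      forall c, D c -> op_le c a
    & forall e, self_adjoint_part M e -> (forall c, D c -> op_le c e) ->
        op_le a e].

(* tau is a function on all maps H -> H, but only its values on M matter. *)
Record faithful_normal_tracial_state M (tau : (H -> H) -> R[i]) : Prop := {
  tau_linear : forall (k : R[i]) a c, M a -> M c ->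
    tau (k *: a + c) = k * tau a + tau c;
  tau_positive : forall a, M a -> op_le 0 a -> 0 <= tau a;
  tau_one : tau idfun = 1;
  tau_trace : forall a c, M a -> M c -> tau (a \o c) = tau (c \o a);
  tau_faithful : forall a, M a -> op_le 0 a -> tau a = 0 -> a = 0;
  tau_normal : forall D a, D `<=` self_adjoint_part M -> op_directed D ->
    is_op_lub M D a ->
    complex.Re (tau a) = sup [set complex.Re (tau c) | c in D] }.

(* Compactly supported projection-valued Borel measures E on the real line with
   b = \int l dE(l), that is <b x, x> = \int l d<E(l) x, x> for all x.  The
   countable additivity of E is that of the measures A |-> <E(A) x, x>. *)
Record is_spectral_measure (b : H -> H) (E : set R -> H -> H) : Prop := {
  sm_projection : forall A, measurable A -> is_projection (E A);
  sm_full : E setT = idfun;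
  sm_setI : forall A B, measurable A -> measurable B ->
    E (A `&` B) = E A \o E B;
  sm_support : exists K : R, E `[- K, K]%classic = idfun;
  sm_integral : forall x : H, exists mu : {measure set R -> \bar R},
    [/\ forall A, measurable A -> mu A = (complex.Re (dot (E A x) x))%:E,
        mu.-integrable setT (fun l : R => l%:E)
      & (\int[mu]_l (l : R)%:E)%E = (complex.Re (dot (b x) x))%:E] }.

(* The spectral theorem provides, for self-adjoint bounded b, a spectral measure
   that is unique on Borel sets. *)
Definition spectral_projection (b : H -> H) : set R -> H -> H :=
  get (is_spectral_measure b).

Definition unit_interval M : set (H -> H) :=
  [set a | [/\ M a, op_le 0 a & op_le a idfun]].

Definition op_interval M p q : set (H -> H) :=
  [set a | [/\ unit_interval M a, op_le p a & op_le a q]].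

Section SpectralScale.
Variables (M : set (H -> H)) (tau : (H -> H) -> R[i]).
Variables (n : nat) (b : 'I_n -> H -> H).

(* tau is real on self-adjoint elements and tau (b_i a) is real for a and b_i
   self-adjoint, so that taking real parts only serves to land in R. *)
Definition Psi a : 'rV[R]_(1 + n) :=
  row_mx (\row_(_ < 1) complex.Re (tau a))
         (\row_(i < n) complex.Re (tau (b i \o a))).

Definition spectral_scale : set 'rV[R]_(1 + n) := Psi @` unit_interval M.

Definition lincomb (t : 'rV[R]_n) : H -> H :=
  \sum_(i < n) (t 0 i)%:C%C *: b i.

Definition spectral_pair (s : R) (t : 'rV[R]_n) : Prop := t != 0.

Definition proj_le (s : R) (t : 'rV[R]_n) : H -> H :=
  spectral_projection (lincomb t) `]-oo, s]%classic.

Definition proj_lt (s : R) (t : 'rV[R]_n) : H -> H :=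
  spectral_projection (lincomb t) `]-oo, s[%classic.

End SpectralScale.
End Operators.

Section ConvexGeometry.
Variables (R : realType) (m : nat).
Implicit Types (C F P : set 'rV[R]_m) (x y z c : 'rV[R]_m).

Definition hyperplane c (al : R) : set 'rV[R]_m :=
  [set x | \sum_(i < m) c 0 i * x 0 i = al].

Definition boundary C : set 'rV[R]_m := closure C `\` interior C.

Definition support_hyperplane C P : Prop :=
  exists c, exists al : R,
    [/\ c != 0, P = hyperplane c al, P `&` boundary C !=set0
      & C `<=` [set x | \sum_(i < m) c 0 i * x 0 i <= al] \/
        C `<=` [set x | al <= \sum_(i < m) c 0 i * x 0 i]].

Definition is_face C F : Prop :=
  [/\ F `<=` C, convex_set (F : set (convex_lmodType 'rV[R]_m))
    & forall x y (l : R), C x -> C y -> 0 < l < 1 ->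
        F (l *: x + (1 - l) *: y) -> F x /\ F y].

Definition exposed_face C F : Prop :=
  [/\ is_face C F, F !=set0
    & exists2 P, support_hyperplane C P & F = C `&` P].

Definition exposed_point C x : Prop := exposed_face C [set x].

Definition extreme_point C x : Prop :=
  C x /\ forall y z (l : R), C y -> C z -> 0 < l < 1 ->
    x = l *: y + (1 - l) *: z -> y = x /\ z = x.

End ConvexGeometry.

(* Main.v *)
Require Import Defs.
From HB Require Import structures.
From mathcomp Require Import all_boot all_order all_algebra.
From mathcomp Require Import complex.
From mathcomp Require Import all_classical all_reals all_analysis.
From mathcomp Require Import ring lra.
Import Order.TTheory GRing.Theory Num.Theory.
Import numFieldNormedType.Exports.

Set Implicit Arguments.
Unset Strict Implicit.
Unset Printing Implicit Defensive.

Local Open Scope classical_set_scope.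
Local Open Scope ring_scope.

(** Write c for b_t - s, and m <= p for the spectral projections of b_t for the
    open and the closed half-line ending at s.  A linear functional on the
    spectral scale whose component on the last n coordinates is t has, up to sign,
    the value tau (c a) at Psi a, so that exposed faces are the sets where such
    expressions are minimal.  Let c+ and c- be the positive and negative parts of
    c: c vanishes on the range of p - m, hence

      tau (c a) - tau (c m) = tau (c+ a) + tau (c- (1 - a)).

    Both terms are nonnegative (interval_min), and since tau is a faithful trace
    they vanish exactly when c+ a = 0 and c- (1 - a) = 0, that is when
    m <= a <= p (interval_min_eq).  Thus the face where the functional is minimal
    is Psi [m, p].  When t = 0 the functional sees only tau a, and the face is the
    vertex Psi 0 or Psi 1, which is obtained from any nonzero t and an s outside
    of the spectrum.  Finally Psi [m, p] is a point only if tau (p - m) = 0, that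
    is m = p, and p - m is the projection on the eigenspace of s.

    Most of the work is to know the projections m and p.  They are the values of a
    projection-valued measure, so the spectral theorem has to provide one, and then
    every such measure has to give projections in M with the right position with
    respect to b.  The notion that serves both purposes is that of a spectral cut
    of b at s: a projection commuting with b such that b <= s on its range and
    b > s on the complement.
    - A cut is the projection on the kernel of |c| + c, where |c| is the square
      root of c ^ 2 (psd_sqrt, cut_exists).
    - Cuts increase with s and commute with whatever commutes with b
      (cut_mono, cut_commute); by the bicommutant property they lie in M.
    - The cuts of b at all s give Stieltjes measures of <p_s x, x>; Dynkin's
      theorem extends them to projections for all Borel sets, and slicing the
      spectrum gives the integral formula (spectral_measure_exists).
    - For any spectral measure of b the closed half-line gives a cut of b, and the
      complement of the open half-line a cut of - b (sm_cut_le, sm_cut_lt). *)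

(** * The Hilbert space as a real inner product space *)

Section Hilbert.
Variables (R : realType) (H : completeNormedModType R[i]).
Variable dot : {dot H for Num.conj}.
Hypothesis hdot : hilbert_dot dot.

Definition real_dot (x y : H) : R := complex.Re (dot x y).
Local Notation ip := real_dot.

Definition nrm (x : H) : R := complex.Re `|x|.

(** Real scalars act on H through the complex ones; a separate constant keeps the
    complex scalar structure out of the way when rewriting. *)
Definition rscale (r : R) (x : H) : H := r%:C%C *: x.

Lemma Re_add (z w : R[i]) : complex.Re (z + w) = complex.Re z + complex.Re w.
Proof. by case: z; case: w. Qed.

Lemma Re_opp (z : R[i]) : complex.Re (- z) = - complex.Re z.
Proof. by case: z. Qed.

Lemma Re_rscale (r : R) (z : R[i]) : complex.Re (r%:C%C * z) = r * complex.Re z.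
Proof. by case: z => a b /=; rewrite mul0r subr0. Qed.

Lemma Re_conj (z : R[i]) : complex.Re (Num.conj z) = complex.Re z.
Proof. by case: z. Qed.

Lemma dotDl x y z : dot (x + y) z = dot x z + dot y z.
Proof. exact: linearDl. Qed.

Lemma dotDr x y z : dot x (y + z) = dot x y + dot x z.
Proof. exact: linearDr. Qed.

Lemma dotZl k x y : dot (k *: x) y = k * dot x y.
Proof. exact: linearZl_LR. Qed.

Lemma dotZr k x y : dot x (k *: y) = Num.conj k * dot x y.
Proof. exact: linearZr_LR. Qed.

Lemma dotC x y : dot x y = Num.conj (dot y x).
Proof. by rewrite hermC expr0 mul1r. Qed.

Lemma ipC x y : ip x y = ip y x.
Proof. by rewrite /real_dot hermC expr0 mul1r Re_conj. Qed.

Lemma ipDl x y z : ip (x + y) z = ip x z + ip y z.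
Proof. by rewrite /real_dot linearDl Re_add. Qed.

Lemma ipNl x z : ip (- x) z = - ip x z.
Proof. by rewrite /real_dot linearNl Re_opp. Qed.

Lemma ipBl x y z : ip (x - y) z = ip x z - ip y z.
Proof. by rewrite ipDl ipNl. Qed.

Lemma ipZl r x z : ip (rscale r x) z = r * ip x z.
Proof. by rewrite /real_dot linearZl_LR Re_rscale. Qed.

Lemma ip0l z : ip 0 z = 0.
Proof. by rewrite /real_dot linear0l. Qed.

Lemma ipDr x y z : ip z (x + y) = ip z x + ip z y.
Proof. by rewrite ipC ipDl !(ipC z). Qed.

Lemma ipNr x z : ip z (- x) = - ip z x.
Proof. by rewrite ipC ipNl (ipC z). Qed.

Lemma ipBr x y z : ip z (x - y) = ip z x - ip z y.
Proof. by rewrite ipC ipBl !(ipC z). Qed.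

Lemma ipZr r x z : ip z (rscale r x) = r * ip z x.
Proof. by rewrite ipC ipZl (ipC z). Qed.

Lemma ip0r z : ip z 0 = 0.
Proof. by rewrite ipC ip0l. Qed.

Lemma normH (x : H) : `|x| = (nrm x)%:C%C.
Proof. by rewrite /nrm RRe_real // ger0_real. Qed.

Lemma nrm_ge0 x : 0 <= nrm x.
Proof. by rewrite -lecR -normH normr_ge0. Qed.

Lemma dotxx x : dot x x = (nrm x ^+ 2)%:C%C.
Proof. by rewrite -hdot normH -rmorphXn. Qed.

Lemma ipxx x : ip x x = nrm x ^+ 2.
Proof. by rewrite /real_dot dotxx. Qed.

Lemma ipxx_ge0 x : 0 <= ip x x.
Proof. by rewrite ipxx sqr_ge0. Qed.

Lemma nrm0 : nrm 0 = 0.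
Proof. by rewrite /nrm normr0. Qed.

Lemma nrm_eq0 x : nrm x = 0 -> x = 0.
Proof. by move=> x0; apply/eqP; rewrite -normr_eq0 normH x0. Qed.

Lemma nrmN x : nrm (- x) = nrm x.
Proof. by rewrite /nrm normrN. Qed.

Lemma nrmB x y : nrm (x - y) = nrm (y - x).
Proof. by rewrite -nrmN opprB. Qed.

Lemma nrmD x y : nrm (x + y) <= nrm x + nrm y.
Proof. by have := ler_normD x y; rewrite !normH -rmorphD lecR. Qed.

Lemma nrmZ r x : nrm (rscale r x) = `|r| * nrm x.
Proof.
have : (nrm (rscale r x))%:C%C = `|r%:C%C| * (nrm x)%:C%C.
  by rewrite -!normH normrZ.
by rewrite normc_def /= expr0n addr0 sqrtr_sqr -rmorphM => /complexI.
Qed.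

Lemma ipxx_eq0 x : ip x x = 0 -> x = 0.
Proof. by rewrite ipxx => /eqP; rewrite sqrf_eq0 => /eqP/nrm_eq0. Qed.

Lemma ipxx_le0 x : ip x x <= 0 -> x = 0.
Proof.
by move=> x0; apply: ipxx_eq0; apply/eqP; rewrite eq_le x0 ipxx_ge0.
Qed.

Section Linear.
Variable a : H -> H.
Hypothesis la : linear a.

Lemma linD x y : a (x + y) = a x + a y.
Proof. by have := la 1 x y; rewrite !scale1r. Qed.

Lemma lin0 : a 0 = 0.
Proof. by have := linD 0 0; rewrite addr0 -[LHS]addr0 => /addrI. Qed.

Lemma linZ k x : a (k *: x) = k *: a x.
Proof. by have := la k x 0; rewrite !addr0 lin0 addr0. Qed.

Lemma linN x : a (- x) = - a x.
Proof. by rewrite -scaleN1r linZ scaleN1r. Qed.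

Lemma linB x y : a (x - y) = a x - a y.
Proof. by rewrite linD linN. Qed.

Lemma linR r x : a (rscale r x) = rscale r (a x).
Proof. exact: linZ. Qed.

End Linear.

Definition bounded_by (a : H -> H) (K : R) := forall x, nrm (a x) <= K * nrm x.

(** Cauchy-Schwarz for the form of a positive operator: the form is nonnegative
    along the line x + r y, so its discriminant as a polynomial in r is not
    positive. *)
Lemma psd_cauchy_schwarz (a : H -> H) x y : linear a -> self_adjoint dot a ->
  (forall z, 0 <= ip (a z) z) -> ip (a x) y ^+ 2 <= ip (a x) x * ip (a y) y.
Proof.
move=> la sa pa.
have sym u v : ip (a u) v = ip (a v) u by rewrite /real_dot sa -/(ip _ _) ipC.
have q r : 0 <= ip (a x) x + (r * ip (a x) y) *+ 2 + r ^+ 2 * ip (a y) y.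
  have := pa (x + rscale r y).
  rewrite (linD la) (linR la) !(ipDl, ipDr, ipZl, ipZr) (sym y x).
  by congr (0 <= _); ring.
have py := pa y; have px := pa x.
move: q px py; set A := ip (a x) x; set B := ip (a x) y; set D := ip (a y) y.
move=> q px; rewrite le_eqVlt => /orP[/eqP D0|D0].
  rewrite -D0 mulr0.
  (* the polynomial A + 2 B r is affine, so B has to vanish *)
  have := sqr_ge0 B; rewrite le_eqVlt => /orP[/eqP<-//|B2].
  have : 0 <= A * (B^+2) by rewrite mulr_ge0 // ltW.
  have := q (- (A + 1) / B); rewrite -D0 mulr0 addr0.
  have B0 : B != 0 by rewrite -sqrf_eq0 gt_eqF.
  by rewrite divfK //; lra.
have := q (- B / D).
have -> : A + (- B / D * B) *+ 2 + (- B / D) ^+ 2 * D = (A * D - B ^+ 2) / D.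
  by field; rewrite gt_eqF.
by rewrite pmulr_lge0 ?invr_gt0 // subr_ge0.
Qed.

Lemma id_linear : linear (@idfun H).
Proof. by []. Qed.

Lemma cauchy_schwarz_sq x y : ip x y ^+ 2 <= ip x x * ip y y.
Proof.
by apply: (@psd_cauchy_schwarz idfun) => // z; exact: ipxx_ge0.
Qed.

Lemma cauchy_schwarz x y : ip x y <= nrm x * nrm y.
Proof.
apply: le_trans (ler_norm _) _.
rewrite -(@ler_pXn2r _ 2) ?nnegrE ?mulr_ge0 ?nrm_ge0 //.
by rewrite real_normK ?num_real // exprMn -!ipxx cauchy_schwarz_sq.
Qed.

Lemma le_nrm_sq x (K : R) : 0 <= K -> ip x x <= K ^+ 2 -> nrm x <= K.
Proof.
by move=> K0; rewrite ipxx ler_pXn2r ?nnegrE ?nrm_ge0.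
Qed.

(** Where the form of a positive operator vanishes, so does the operator, by
    Cauchy-Schwarz against its own value. *)
Lemma psd_ker (a : H -> H) x : linear a -> self_adjoint dot a ->
  (forall z, 0 <= ip (a z) z) -> ip (a x) x <= 0 -> a x = 0.
Proof.
move=> la sa pa ax0; apply: ipxx_eq0; apply/eqP; rewrite -sqrf_eq0.
rewrite eq_le sqr_ge0 andbT (le_trans (psd_cauchy_schwarz _ _ la sa pa)) //.
have -> : ip (a x) x = 0 by apply/eqP; rewrite eq_le ax0 pa.
by rewrite mul0r.
Qed.

End Hilbert.

(** * Self-adjoint operators, completeness and boundedness *)

Section Completeness.
Variables (R : realType) (H : completeNormedModType R[i]).
Variable dot : {dot H for Num.conj}.
Hypothesis hdot : hilbert_dot dot.
Local Notation ip := (real_dot dot).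

Lemma dot_sa_real (a : H -> H) x : self_adjoint dot a ->
  dot (a x) x = (ip (a x) x)%:C%C.
Proof.
move=> sa; apply/eqP; rewrite eq_complex /= eqxx andTb.
have : dot (a x) x = Num.conj (dot (a x) x).
  by rewrite {1}sa hermC expr0 mul1r.
rewrite /real_dot; case: (dot (a x) x) => u v /= /eqP.
by rewrite eq_complex /= => /andP[_ /eqP]; lra.
Qed.

Lemma op_le_ip (a c : H -> H) x : op_le dot a c -> ip (a x) x <= ip (c x) x.
Proof. by move=> /(_ x); rewrite lecE => /andP[]. Qed.

(** For self-adjoint operators the complex order of values of the forms is that of
    their real parts. *)
Lemma op_leP (a c : H -> H) : self_adjoint dot a -> self_adjoint dot c ->
  op_le dot a c <-> forall x, ip (a x) x <= ip (c x) x.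
Proof.
move=> sa sc; split=> [ac x|ac x]; first exact: op_le_ip.
by rewrite !dot_sa_real // lecR.
Qed.

Lemma sa0 : self_adjoint dot (0 : H -> H).
Proof. by move=> x y; rewrite linear0l linear0r. Qed.

Lemma sa_id : self_adjoint dot (@idfun H).
Proof. by []. Qed.

Lemma saD (a c : H -> H) : self_adjoint dot a -> self_adjoint dot c ->
  self_adjoint dot (a + c).
Proof.
move=> sa sc x y; rewrite -[LHS]/(dot (a x + c x) y) -[RHS]/(dot x (a y + c y)).
by rewrite dotDl dotDr sa sc.
Qed.

Lemma saN (a : H -> H) : self_adjoint dot a -> self_adjoint dot (- a).
Proof.
move=> sa x y; rewrite -[LHS]/(dot (- a x) y) -[RHS]/(dot x (- a y)).
by rewrite linearNl linearNr; congr (- _); exact: sa.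
Qed.

Lemma saB (a c : H -> H) : self_adjoint dot a -> self_adjoint dot c ->
  self_adjoint dot (a - c).
Proof. by move=> sa sc; apply: saD => //; exact: saN. Qed.

Lemma saZ (r : R) (a : H -> H) : self_adjoint dot a ->
  self_adjoint dot (r%:C%C *: a).
Proof.
move=> sa x y; rewrite -[LHS]/(dot (r%:C%C *: a x) y) -[RHS]/(dot x (r%:C%C *: a y)).
rewrite dotZl dotZr sa; congr (_ * _).
by apply/eqP; rewrite eq_complex /= oppr0 !eqxx.
Qed.

Lemma sa_comp (a c : H -> H) : self_adjoint dot a -> self_adjoint dot c ->
  a \o c = c \o a -> self_adjoint dot (a \o c).
Proof. by move=> sa sc ac x y; rewrite [in RHS]ac /= sa sc. Qed.

(** That the form is real at x + y and at x + i y relates the imaginary and the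
    real parts of dot (a x) y and dot (a y) x. *)
Lemma psd_sa (a : H -> H) : linear a -> op_le dot 0 a -> self_adjoint dot a.
Proof.
move=> la pa.
have re x : complex.Im (dot (a x) x) = 0.
  by have := pa x; rewrite linear0l lecE => /andP[/eqP-> _].
have anti x y : complex.Im (dot (a x) y) = - complex.Im (dot (a y) x).
  have := re (x + y); rewrite (linD la) dotDl !dotDr.
  have := re x; have := re y.
  case: (dot (a x) x) (dot (a y) y) (dot (a x) y) (dot (a y) x).
  by move=> ? ? [? ?] [? ?] [? ?] /= -> ->; lra.
move=> x y; rewrite [RHS]dotC.
have := anti x y; have := anti x ('i *: y).
rewrite (linZ la) dotZl dotZr /=.
case: (dot (a x) y) (dot (a y) x) => u v [w z] /= h1 h2.
by apply/eqP; rewrite eq_complex /=; apply/andP; split; apply/eqP; lra.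
Qed.

(** Polarization at x and d x. *)
Lemma sa_diag0 (d : H -> H) : linear d -> self_adjoint dot d ->
  (forall x, ip (d x) x = 0) -> d = 0.
Proof.
move=> ld sd qd; apply/funext => x; apply/(ipxx_eq0 hdot).
have sym : ip (d (d x)) x = ip (d x) (d x).
  by exact: (congr1 (@complex.Re R) (sd _ _)).
have := qd (x + d x); rewrite (linD ld) !(ipDl, ipDr) !qd sym.
by lra.
Qed.

Lemma lin_add (a c : H -> H) : linear a -> linear c -> linear (a + c).
Proof.
move=> la lc k x y.
rewrite -[LHS]/(a (k *: x + y) + c (k *: x + y)).
rewrite -[RHS]/(k *: (a x + c x) + (a y + c y)).
by rewrite la lc scalerDr addrACA.
Qed.

Lemma lin_opp (a : H -> H) : linear a -> linear (- a).
Proof.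
move=> la k x y; rewrite -[LHS]/(- a (k *: x + y)) -[RHS]/(k *: - a x - a y).
by rewrite la opprD scalerN.
Qed.

Lemma lin_sub (a c : H -> H) : linear a -> linear c -> linear (a - c).
Proof. by move=> la lc; apply: lin_add => //; exact: lin_opp. Qed.

Lemma lin_scale h (a : H -> H) : linear a -> linear (h *: a).
Proof.
move=> la k x y.
rewrite -[LHS]/(h *: a (k *: x + y)) -[RHS]/(k *: (h *: a x) + h *: a y).
by rewrite la scalerDr !scalerA mulrC.
Qed.

Lemma lin_comp (a c : H -> H) : linear a -> linear c -> linear (a \o c).
Proof. by move=> la lc k x y; rewrite /= lc la. Qed.

Lemma lin_zero : linear (0 : H -> H).
Proof.
move=> k x y; rewrite -[LHS]/(0 : H) -[RHS]/(k *: 0 + 0 : H).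
by rewrite scaler0 addr0.
Qed.

Lemma sa_ext (a c : H -> H) : linear a -> linear c ->
  self_adjoint dot a -> self_adjoint dot c ->
  (forall x, ip (a x) x = ip (c x) x) -> a = c.
Proof.
move=> la lc sa sc ac; apply/eqP; rewrite -subr_eq0; apply/eqP.
apply: sa_diag0 => [||x]; [exact: lin_sub|exact: saB|].
by rewrite -[(a - c) x]/(a x - c x) ipBl ac subrr.
Qed.

(** Estimates below hold uniformly from each rank on, so one small term of the
    bounding sequence does the work of convergence to zero. *)
Definition gets_small (e : nat -> R) := forall d, 0 < d -> exists k, e k <= d.

Lemma gets_small_le0 (e : nat -> R) (q C : R) : gets_small e -> 0 <= C ->
  (forall k, q <= C * e k) -> q <= 0.
Proof.
move=> e0 C0 qe; rewrite leNgt; apply/negP => q0.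
have C1 : 0 < C + 1 by lra.
have [k ek] := e0 (q / (C + 1) / 2) ltac:(by rewrite !divr_gt0).
have := qe k; apply/negP; rewrite -ltNge.
apply: (@le_lt_trans _ _ (C * (q / (C + 1) / 2))); first exact: ler_wpM2l.
have -> : C * (q / (C + 1) / 2) = (C / (C + 1)) * (q / 2) by field; lra.
have : C / (C + 1) <= 1 by rewrite ler_pdivrMr; lra.
by nra.
Qed.

Lemma hilbert_complete (u : nat -> H) (e : nat -> R) : gets_small e ->
  (forall k m, (k <= m)%N -> nrm (u m - u k) <= e k) ->
  exists l, forall k, nrm (l - u k) <= e k.
Proof.
move=> e0 cu.
have cau : cauchy_ex (u @ \oo).
  move=> eps eps0; have er : eps = (complex.Re eps)%:C%C.
    by rewrite RRe_real // gtr0_real.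
  have rp : 0 < complex.Re eps by rewrite -ltcR -er.
  have [k ek] := e0 (complex.Re eps / 2) ltac:(by rewrite divr_gt0).
  exists (u k); exists k => // m /= km; rewrite -ball_normE /= er normH ltcR.
  by rewrite nrmB; apply: le_lt_trans (cu _ _ km) _; lra.
have /cauchy_exP/cauchy_cvgP/cvg_ex[l ul] := cau.
exists l => k; apply/ler_addgt0Pr => d d0.
have dp : 0 < d%:C%C :> R[i] by rewrite ltcR.
have [N _ uN] : \forall t \near \oo, `|l - u t| < d%:C%C.
  exact: cvgr_dist_lt.
have := uN (maxn N k) (leq_maxl _ _).
rewrite normH ltcR => /ltW lu.
have -> : l - u k =
    (l - u (maxn N k)) + (u (maxn N k) - u k).
  by rewrite addrA subrK.
by rewrite addrC; apply: le_trans (nrmD _ _) _; rewrite lerD // cu // leq_maxr.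
Qed.

(** Continuity is only used through norm bounds. *)
Lemma bounded_opP (a : H -> H) :
  bounded_op a <-> linear a /\ exists2 K, 0 <= K & bounded_by a K.
Proof.
split=> [[la ca]|[la [K K0 aK]]]; split=> //;
  pose f : {linear H -> H} := HB.pack a (GRing.isLinear.Build _ _ _ _ a la).
  have /linear_boundedP : bounded_near f (nbhs (0 : H)).
    exact/linear_bounded_continuous.
  move=> /pinfty_ex_gt0 [r r0 Bf].
  have [t er] : exists t : R, r = t%:C%C.
    by exists (complex.Re r); rewrite RRe_real // gtr0_real.
  move: r0 Bf; rewrite er => t0 Bf; exists t; first by rewrite -lecR ltW.
  by move=> x; have := Bf x; rewrite !normH -rmorphM lecR.
have : bounded_near f (nbhs (0 : H)).
  apply/linear_boundedP; exists K%:C%C; split.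
    by apply/complex_realP; exists K.
  move=> r Kr x; rewrite -[f x]/(a x); apply: (@le_trans _ _ (K%:C%C * `|x|)).
    by rewrite !normH -rmorphM lecR.
  by rewrite ler_wpM2r // ltW.
exact: bounded_linear_continuous.
Qed.

End Completeness.

(** * Square roots of positive operators *)

Section Roots.
Variables (R : realType) (H : completeNormedModType R[i]).
Variable dot : {dot H for Num.conj}.
Hypothesis hdot : hilbert_dot dot.
Local Notation ip := (real_dot dot).

Lemma nrm_scale (k : R[i]) (x : H) : nrm (k *: x) = complex.Re `|k| * nrm x.
Proof.
have : (nrm (k *: x))%:C%C = (complex.Re `|k|)%:C%C * (nrm x)%:C%C.
  by rewrite -!normH normrZ RRe_real // normr_real.
by rewrite -rmorphM => /complexI.
Qed.

(** Symmetry for the real form gives the complex one, by evaluating at i y. *)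
Lemma real_sa (a : H -> H) : linear a ->
  (forall x y, ip (a x) y = ip x (a y)) -> self_adjoint dot a.
Proof.
move=> la sym x y; have := sym x y; have := sym x ('i *: y).
rewrite /real_dot (linZ la) !dotZr.
case: (dot (a x) y) (dot x (a y)) => u v [w z] /= h1 h2.
by apply/eqP; rewrite eq_complex /=; apply/andP; split; apply/eqP; lra.
Qed.

(** A bound on the form of a positive operator is a bound on its norm, by
    Cauchy-Schwarz between x and a x. *)
Lemma psd_bounded_by (a : H -> H) (K : R) : linear a -> self_adjoint dot a -> 0 <= K ->
  (forall x, 0 <= ip (a x) x <= K * ip x x) -> bounded_by a K.
Proof.
move=> la sa K0 pa x.
have pa0 z : 0 <= ip (a z) z by have /andP[] := pa z.
have := psd_cauchy_schwarz x (a x) la sa pa0.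
have /andP[A0 A1] := pa x; have /andP[B0 B1] := pa (a x).
rewrite !(ipxx hdot) in A1 B1 *.
have := nrm_ge0 (a x); rewrite le_eqVlt => /orP[/eqP<-|n0] le.
  by rewrite mulr_ge0 ?nrm_ge0.
rewrite -(@ler_pXn2r _ 2) ?nnegrE ?mulr_ge0 ?nrm_ge0 //.
have n20 : 0 < nrm (a x) ^+ 2 by rewrite exprn_gt0.
rewrite -(ler_pM2l n20) -expr2 (le_trans le) //.
have -> : nrm (a x) ^+ 2 * (K * nrm x) ^+ 2 =
  (K * nrm x ^+ 2) * (K * nrm (a x) ^+ 2) by ring.
exact: ler_pM.
Qed.

Lemma lim_ext (e : nat -> R) (u : nat -> H) l l' A B : gets_small e ->
  0 <= A -> 0 <= B ->
  (forall k, nrm (l - u k) <= A * e k) ->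
  (forall k, nrm (l' - u k) <= B * e k) -> l = l'.
Proof.
move=> e0 A0 B0 ul ul'; apply/eqP; rewrite -subr_eq0; apply/eqP/nrm_eq0.
apply/eqP; rewrite eq_le nrm_ge0 andbT.
apply: (gets_small_le0 e0 (addr_ge0 A0 B0)) => k.
have -> : l - l' = (l - u k) - (l' - u k) by rewrite opprB addrA subrK.
by rewrite mulrDl (le_trans (nrmD _ _)) // nrmN lerD.
Qed.

(** Linearity passes to pointwise limits with an error A x * e k that is uniform
    enough in x. *)
Lemma lim_linear (e : nat -> R) (y : nat -> H -> H) (l : H -> H) (A : H -> R) :
  gets_small e -> (forall x, 0 <= A x) -> (forall k, 0 <= e k) ->
  (forall n, linear (y n)) ->
  (forall x k, nrm (l x - y k x) <= A x * e k) -> linear l.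
Proof.
move=> e0 A0 pe ly yl c x z.
apply: (@lim_ext e (fun k => y k (c *: x + z)) _ _ (A (c *: x + z))
  (complex.Re `|c| * A x + A z)) => // [|k].
  by rewrite addr_ge0 ?mulr_ge0 // -lecR RRe_real ?normr_real ?normr_ge0.
rewrite (ly k) opprD addrACA -scalerBr (le_trans (nrmD _ _)) // mulrDl lerD //.
rewrite nrm_scale -mulrA ler_wpM2l // -lecR RRe_real ?normr_real //.
exact: normr_ge0.
Qed.

Lemma lim_sym (e : nat -> R) (y : nat -> H -> H) (l : H -> H) (A : H -> R) :
  gets_small e -> (forall x, 0 <= A x) -> (forall k, 0 <= e k) ->
  (forall n, self_adjoint dot (y n)) ->
  (forall x k, nrm (l x - y k x) <= A x * e k) ->
  forall x z, ip (l x) z = ip x (l z).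
Proof.
move=> e0 A0 pe sy yl.
suff le x z : ip (l x) z - ip x (l z) <= 0.
  move=> x z; apply/eqP; rewrite eq_le -![_ <= ip _ _]subr_le0 le /=.
  by rewrite ipC (ipC _ (l x)) le.
apply: (@gets_small_le0 _ e _ (A x * nrm z + A z * nrm x)) => // [|k].
  by rewrite addr_ge0 // mulr_ge0 ?nrm_ge0.
have sk : ip (y k x) z = ip x (y k z).
  exact: (congr1 (@complex.Re R) (sy k x z)).
have -> : ip (l x) z - ip x (l z) =
    ip (l x - y k x) z + ip (- (l z - y k z)) x.
  by rewrite ipNl !ipBl sk !(ipC _ _ x); ring.
rewrite mulrDl lerD // (le_trans (cauchy_schwarz hdot _ _)) ?nrmN //;
  rewrite mulrAC ler_wpM2r //.
  exact: nrm_ge0.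
exact: nrm_ge0.
Qed.

Lemma gets_smallM (e : nat -> R) C : (forall k, 0 <= e k) -> 0 <= C -> gets_small e ->
  gets_small (fun k => C * e k).
Proof.
move=> pe C0 ve d d0; have C1 : 0 < C + 1 by lra.
have [k kd] := ve _ (divr_gt0 d0 C1); exists k.
rewrite ler_pdivlMr // in kd; apply: le_trans kd.
by rewrite mulrC ler_wpM2l // lerDl.
Qed.

Section SquareRoot.
Variable T : H -> H.
Hypotheses (lT : linear T) (sT : self_adjoint dot T).
Hypothesis T01 : forall x, 0 <= ip (T x) x <= ip x x.

Let X : H -> H := idfun - T.

Fixpoint sqrt_iter n : H -> H :=
  if n is m.+1 then (2^-1)%:C%C *: (X + (sqrt_iter m \o sqrt_iter m)) else 0.

Fixpoint sqrt_maj n : R :=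
  if n is m.+1 then (1 + sqrt_maj m ^+ 2) / 2 else 0.

Local Notation y := sqrt_iter.
Local Notation s := sqrt_maj.

Let lX : linear X. Proof. exact: lin_sub (@id_linear R H) lT. Qed.

Let sX : self_adjoint dot X.
Proof. exact: saB (@sa_id _ _ dot) sT. Qed.

Let lin_y n : linear (y n).
Proof.
elim: n => [|n IH] /=; first exact: lin_zero.
by apply/lin_scale/lin_add => //; exact: lin_comp.
Qed.

Let sa_y n : self_adjoint dot (y n).
Proof.
elim: n => [|n IH]; first exact: sa0.
by apply: saZ; apply: saD; [exact: sX|apply: sa_comp].
Qed.

Let X_bound : bounded_by X 1.
Proof.
apply: psd_bounded_by => // x.
rewrite -[X x]/(x - T x) ipBl mul1r.
by have /andP[h1 h2] := T01 x; apply/andP; split; lra.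
Qed.

Let s01 n : 0 <= s n <= 1.
Proof.
elim: n => [|n /andP[h1 h2]] /=; first by rewrite lexx ler01.
by apply/andP; split; nra.
Qed.

Let s_gets_small : gets_small (fun k => 1 - s k).
Proof.
have le k : (1 - s k) * k.+1%:R <= 2.
  elim: k => [|k IH]; first by rewrite /= subr0 mul1r; lra.
  rewrite -[s k.+1]/((1 + s k ^+ 2) / 2).
  have /andP[h1 h2] := s01 k; case: k IH h1 h2 => [|k] IH h1 h2.
    by rewrite /=; lra.
  move: (s k.+1) IH h1 h2 => t IH h1 h2.
  have : 0 <= k%:R :> R by [].
  rewrite -addn2 natrD in IH; rewrite -addn3 natrD.
  move: IH; move: (k%:R : R) => a IH a0.
  have u0 : 0 < a + 2 by lra.
  have u1 : 0 < a + 3 by lra.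
  rewrite -ler_pdivlMr // in IH; rewrite -ler_pdivlMr //.
  apply: (@le_trans _ _ (2 / (a + 2) * (2 - 2 / (a + 2)) / 2)).
    have : 2 / (a + 2) <= 1 by rewrite ler_pdivrMr; lra.
    move: (2 / (a + 2)) IH => w IH w1.
    have : 0 <= (w - (1 - t)) * (1 - w + t) by apply: mulr_ge0; lra.
    by nra.
  rewrite ler_pdivlMr // -subr_ge0.
  have -> : 2 - 2 / (a + 2) * (2 - 2 / (a + 2)) / 2 * (a + 3)
    = 2 / (a + 2) ^+ 2 by field; lra.
  by rewrite divr_ge0 // sqr_ge0.
move=> d d0; have [k kd] : exists k : nat, 2 / d <= k.+1%:R.
  exists (Num.bound (2 / d)); rewrite ltW //.
  have := archi_boundP (divr_ge0 (ler0n R 2) (ltW d0)).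
  by move=> /lt_trans; apply; rewrite ltr_nat.
exists k; have k0 : 0 < k.+1%:R :> R by rewrite ltr0n.
rewrite -(ler_pM2r k0) (le_trans (le k)) //.
by rewrite mulrC -ler_pdivrMr.
Qed.

Let t_ge0 k : 0 <= 1 - s k.
Proof. by have /andP[_] := s01 k; rewrite subr_ge0. Qed.

Let y_S n x : y n.+1 x = rscale (2^-1) (X x + y n (y n x)).
Proof. by []. Qed.

Let nrm_half (z : H) : nrm (rscale (2^-1) z) = nrm z / 2.
Proof. by rewrite nrmZ ger0_norm ?invr_ge0 // mulrC. Qed.

Let y_bound n : bounded_by (y n) (s n).
Proof.
elim: n => [|n IH] x; first by rewrite -[y 0 x]/(0 : H) nrm0 mul0r.
rewrite y_S nrm_half /= mulrAC ler_wpM2r ?invr_ge0 //.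
apply: le_trans (nrmD _ _) _; rewrite mulrDl; apply: lerD; first exact: X_bound.
have /andP[s0 _] := s01 n.
by rewrite (le_trans (IH _)) // expr2 -mulrA ler_wpM2l.
Qed.

Let rscaleB (r : R) (u v : H) : rscale r u - rscale r v = rscale r (u - v).
Proof. by rewrite /rscale scalerBr. Qed.

(* The norm of y_(n+1) - y_n is bounded by the corresponding scalar difference:
   y_n y_n - y_(n-1) y_(n-1) is split without commuting the two iterates. *)
Let step n x : nrm (y n.+1 x - y n x) <= (s n.+1 - s n) * nrm x.
Proof.
elim: n x => [|n IH] x.
  by rewrite subr0 (le_trans (y_bound 1 x)) //= subr0.
rewrite !(y_S n.+1) [X in _ - X]y_S rscaleB nrm_half.
have es : s n.+2 - s n.+1 = (s n.+1 - s n) * (s n.+1 + s n) / 2.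
  by rewrite -[s n.+2]/((1 + s n.+1 ^+ 2) / 2) [X in _ - X]/=; field.
have -> : X x + y n.+1 (y n.+1 x) - (X x + y n (y n x)) =
    y n.+1 (y n.+1 x - y n x) + (y n.+1 (y n x) - y n (y n x)).
  by rewrite (linB (lin_y n.+1)) opprD addrACA subrr add0r addrA subrK.
have /andP[s0 _] := s01 n.
have /andP[s0' _] := s01 n.+1.
have h1 := y_bound n.+1 (y n.+1 x - y n x).
have h2 := IH x; have h3 := IH (y n x); have h4 := y_bound n x.
have h5 := nrmD (y n.+1 (y n.+1 x - y n x)) (y n.+1 (y n x) - y n (y n x)).
have h6 := nrm_ge0 x.
have h7 : 0 <= s n.+1 - s n.
  by rewrite /=; have /andP[_ s1] := s01 n; nra.
have h8 : s n.+1 * nrm (y n.+1 x - y n x) <= s n.+1 * ((s n.+1 - s n) * nrm x).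
  exact: ler_wpM2l.
have h9 : (s n.+1 - s n) * nrm (y n x) <= (s n.+1 - s n) * (s n * nrm x).
  exact: ler_wpM2l.
by rewrite es; nra.
Qed.

Let cauchy_y x k m : (k <= m)%N -> nrm (y m x - y k x) <= (1 - s k) * nrm x.
Proof.
move=> km; apply: (@le_trans _ _ ((s m - s k) * nrm x)).
  rewrite -(subnKC km); elim: (m - k)%N => [|j IH].
    by rewrite addn0 !subrr nrm0 mul0r.
  have -> : y (k + j.+1) x - y k x =
      (y (k + j).+1 x - y (k + j)%N x) + (y (k + j)%N x - y k x).
    by rewrite addnS addrA subrK.
  rewrite (le_trans (nrmD _ _)) // (le_trans (lerD (step _ _) IH)) //.
  by rewrite -mulrDl addrA subrK addnS.
by rewrite ler_wpM2r ?nrm_ge0 // lerB //; have /andP[] := s01 m.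
Qed.

(** Writing r = 1 - y turns r ^ 2 = T into the fixed point equation
    y = ((1 - T) + y ^ 2) / 2, whose iterates from 0 are dominated in norm by the
    scalar iterates of t = (1 + t ^ 2) / 2, which increase to 1. *)
Lemma psd_sqrt : exists r : H -> H,
  [/\ linear r /\ bounded_by r 2, self_adjoint dot r, forall x, 0 <= ip (r x) x,
    r \o r = T & forall d K, linear d -> 0 <= K -> bounded_by d K ->
      d \o T = T \o d -> d \o r = r \o d].
Proof.
have cv x : exists l, forall k, nrm (l - y k x) <= nrm x * (1 - s k).
  apply: hilbert_complete; first by apply: gets_smallM => //; exact: nrm_ge0.
  by move=> k m km; rewrite mulrC; exact: cauchy_y.
have [l yl] := choice cv.
have n0 := @nrm_ge0 R H.
have ll : linear l by apply: (@lim_linear (fun k => 1 - s k) y l (@nrm R H)).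
have bl : bounded_by l 1.
  move=> x; apply/ler_addgt0Pr => d d0; rewrite mul1r.
  have -> : l x = (l x - y 0 x) + y 0 x by rewrite subrK.
  rewrite (le_trans (nrmD _ _)) // -[y 0 x]/(0 : H) nrm0 addr0.
  by rewrite (le_trans (yl x 0)) //= subr0 mulr1 lerDl ltW.
have sl : self_adjoint dot l.
  apply: real_sa => //.
  by apply: (@lim_sym (fun k => 1 - s k) y l (@nrm R H)).
have fp x : l x + l x = X x + l (l x).
  apply: (@lim_ext (fun k => 1 - s k) (fun k => X x + y k (y k x)) _ _
    (nrm x *+ 2) (nrm x *+ 2)) => // [||k|k]; rewrite ?mulrn_wge0 //.
  - have -> : X x + y k (y k x) = y k.+1 x + y k.+1 x.
      rewrite y_S /rscale -scalerDl -rmorphD /=.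
      have -> : (2^-1 + 2^-1 : R) = 1 by field.
      by rewrite scale1r.
    rewrite opprD addrACA (le_trans (nrmD _ _)) // mulrnAl mulr2n.
    have h : nrm (l x - y k.+1 x) <= nrm x * (1 - s k).
      rewrite (le_trans (yl x k.+1)) // ler_wpM2l // lerB //=.
      by have /andP[] := s01 k; nra.
    exact: lerD.
  - have -> : X x + l (l x) - (X x + y k (y k x)) =
        (l (l x) - y k (l x)) + y k (l x - y k x).
      by rewrite (linB (lin_y k)) opprD addrACA subrr add0r addrA subrK.
    rewrite (le_trans (nrmD _ _)) // mulrnAl mulr2n lerD //.
      rewrite (le_trans (yl _ _)) // ler_wpM2r //.
      by have := bl x; rewrite mul1r.
    rewrite (le_trans (y_bound _ _)) // (le_trans _ (yl x k)) //.
    by rewrite ler_piMl //; have /andP[] := s01 k.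
exists (idfun - l); split.
- split; first exact: lin_sub (@id_linear R H) ll.
  move=> x; rewrite -[(idfun - l) x]/(x - l x) (le_trans (nrmD _ _)) // nrmN.
  by have := bl x; lra.
- exact: saB (@sa_id _ _ dot) sl.
- move=> x; rewrite -[(idfun - l) x]/(x - l x) ipBl subr_ge0.
  rewrite (le_trans (cauchy_schwarz hdot _ _)) // (ipxx hdot) expr2 ler_wpM2r //.
  by have := bl x; rewrite mul1r.
- apply/funext => x /=.
  rewrite -[LHS]/((x - l x) - l (x - l x)) (linB ll) opprB addrACA -opprD fp.
  by rewrite -[X x]/(x - T x) (addrAC _ (- T x)) opprB addrC subrK.
move=> d K ld K0 dK dT.
have dX x : d (X x) = X (d x).
  rewrite -[X x]/(x - T x) -[X (d x)]/(d x - T (d x)) (linB ld).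
  by congr (_ - _); exact: (congr1 (fun f => f x) dT).
have dy k x : d (y k x) = y k (d x).
  elim: k x => [|k IH] x; first by rewrite -[y 0 x]/(0 : H) (lin0 ld).
  by rewrite !y_S (linR ld) (linD ld) dX !IH.
have dl x : d (l x) = l (d x).
  apply: (@lim_ext (fun k => 1 - s k) (fun k => y k (d x)) _ _
    (K * nrm x) (nrm (d x))) => // [|k]; first by rewrite mulr_ge0.
  by rewrite -dy -(linB ld) (le_trans (dK _)) // -mulrA ler_wpM2l.
apply/funext => x /=; rewrite -[(idfun - l) x]/(x - l x).
by rewrite -[RHS]/(d x - l (d x)) (linB ld) dl.
Qed.
End SquareRoot.
End Roots.

(** * Orthogonal projections *)

Section Projections.
Variables (R : realType) (H : completeNormedModType R[i]).
Variable dot : {dot H for Num.conj}.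
Hypothesis hdot : hilbert_dot dot.
Local Notation ip := (real_dot dot).
Local Notation is_projection := (is_projection dot).

Lemma ip_ext x y : (forall v, ip x v = ip y v) -> x = y.
Proof.
move=> xy; apply/eqP; rewrite -subr_eq0; apply/eqP/(ipxx_eq0 hdot).
by rewrite ipBl xy subrr.
Qed.

Lemma sa_ip a x y : self_adjoint dot a -> ip (a x) y = ip x (a y).
Proof. by move=> sa; exact: (congr1 (@complex.Re R) (sa x y)). Qed.

Lemma bounded_by_bounded_op a K : linear a -> 0 <= K -> bounded_by a K ->
  @bounded_op R H a.
Proof. by move=> la K0 aK; apply/bounded_opP; split=> //; exists K. Qed.

Section OneProjection.
Variable p : H -> H.
Hypothesis pp : is_projection p.

Lemma proj_lin : linear p.
Proof. by case: pp => -[]. Qed.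

Lemma proj_sa : self_adjoint dot p.
Proof. by case: pp. Qed.

Lemma proj_idem x : p (p x) = p x.
Proof. by case: pp => _ _ /(congr1 (fun f => f x)). Qed.

Lemma proj_ip x y : ip (p x) y = ip x (p y).
Proof. exact: sa_ip proj_sa. Qed.

Lemma proj_form x : ip (p x) x = nrm (p x) ^+ 2.
Proof. by rewrite -(ipxx hdot) [RHS]proj_ip proj_idem proj_ip. Qed.

Lemma proj_compl_ker x : p (x - p x) = 0.
Proof. by rewrite (linB proj_lin) proj_idem subrr. Qed.

Lemma proj_pyth x : nrm x ^+ 2 = nrm (p x) ^+ 2 + nrm (x - p x) ^+ 2.
Proof.
rewrite -!(ipxx hdot) !(ipBl, ipBr) (ipC _ x (p x)) !proj_form -(ipxx hdot).
by ring.
Qed.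

Lemma proj_bounded_by : bounded_by p 1.
Proof.
move=> x; rewrite mul1r -(@ler_pXn2r _ 2) ?nnegrE ?nrm_ge0 //.
by rewrite (proj_pyth x) lerDl sqr_ge0.
Qed.

End OneProjection.

(** Boundedness of an orthogonal projection is automatic. *)
Lemma is_projection_intro p : linear p -> (forall x, p (p x) = p x) ->
  (forall x y, ip (p x) y = ip x (p y)) -> is_projection p.
Proof.
move=> lp idp sp; split; first last.
- by apply/funext => x; exact: idp.
- exact: real_sa lp sp.
apply: (bounded_by_bounded_op lp ler01) => x.
have e : nrm (p x) ^+ 2 = ip x (p x) by rewrite -(ipxx hdot) sp idp.
rewrite mul1r; have := cauchy_schwarz hdot x (p x); rewrite -e expr2.
have := nrm_ge0 (p x); rewrite le_eqVlt => /orP[/eqP<-|n0].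
  by rewrite nrm_ge0.
by rewrite ler_pM2r.
Qed.

Lemma proj0 : is_projection 0.
Proof.
apply: is_projection_intro => [|//|x y]; first exact: lin_zero.
by rewrite ip0l ip0r.
Qed.

Lemma proj1 : is_projection idfun.
Proof. exact: is_projection_intro. Qed.

Lemma proj_compl p : is_projection p -> is_projection (idfun - p).
Proof.
move=> pp; apply: is_projection_intro => [|x|x y].
- exact: lin_sub (@id_linear R H) (proj_lin pp).
- by rewrite -[LHS]/(x - p x - p (x - p x)) proj_compl_ker // subr0.
- rewrite -[(idfun - p) x]/(x - p x) -[(idfun - p) y]/(y - p y).
  by rewrite ipBl ipBr (proj_ip pp).
Qed.

(** Inclusion of ranges is symmetric under composition: take adjoints. *)
Lemma proj_absorb p q : is_projection p -> is_projection q ->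
  (forall x, q (p x) = p x) -> forall x, p (q x) = p x.
Proof.
move=> pp pq qp x; apply: ip_ext => v.
by rewrite (proj_ip pp) (proj_ip pq) qp -(proj_ip pp).
Qed.

(** If P <= Q, then Q is isometric, hence the identity, on the range of P. *)
Lemma range_incl p q : is_projection p -> is_projection q ->
  (forall x, ip (p x) x <= ip (q x) x) -> forall x, q (p x) = p x.
Proof.
move=> pp pq le x.
have := le (p x); rewrite !proj_form // proj_idem // => h.
have := proj_pyth pq (p x) => e.
have : nrm (p x - q (p x)) ^+ 2 <= 0 by move: e h; lra.
rewrite le_eqVlt ltNge sqr_ge0 orbF sqrf_eq0 => /eqP/nrm_eq0/eqP.
by rewrite subr_eq0 => /eqP.
Qed.

(** For self-adjoint a, invariance of the range passes to its orthogonal. *)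
Lemma proj_comm p a : is_projection p -> linear a -> self_adjoint dot a ->
  (forall x, p x = x -> p (a x) = a x) -> p \o a = a \o p.
Proof.
move=> pp la sa inv; apply/funext => x /=; apply: ip_ext => v.
transitivity (ip (p x) (a (p v))).
  have e : a (p v) = p (a (p v)) by rewrite inv ?proj_idem.
  by rewrite (proj_ip pp) (sa_ip _ _ sa) {1}e -(proj_ip pp).
by rewrite -(sa_ip _ _ sa) -(proj_ip pp) inv // proj_idem.
Qed.

(** Closedness is stated along sequences with a rate. *)
Record closed_subspace (V : set H) : Prop := {
  subspace0 : V 0;
  subspaceP : forall k x y, V x -> V y -> V (k *: x + y);
  subspace_lim : forall (u : nat -> H) l e, gets_small e -> (forall k, V (u k)) ->
    (forall k, nrm (l - u k) <= e k) -> V l }.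

Lemma subspace_ker a K : linear a -> 0 <= K -> bounded_by a K ->
  closed_subspace [set x | a x = 0].
Proof.
move=> la K0 aK; split=> /= [|k x y x0 y0|u l e e0 u0 ul]; first exact: lin0.
  by rewrite la x0 y0 scaler0 addr0.
apply: nrm_eq0; apply/eqP; rewrite eq_le nrm_ge0 andbT.
apply: (gets_small_le0 e0 K0) => k.
have -> : a l = a (l - u k) by rewrite (linB la) u0 subr0.
by rewrite (le_trans (aK _)) // ler_wpM2l.
Qed.

Lemma inv_gets_small : gets_small (fun k => k.+1%:R^-1 : R).
Proof.
move=> d d0; exists (Num.bound d^-1).
have d1 : 0 < d^-1 by rewrite invr_gt0.
rewrite -[leRHS]invrK lef_pV2 ?posrE ?ltr0n // ltW //.
by rewrite (lt_trans (archi_boundP (ltW d1))) // ltr_nat.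
Qed.

(** Nearest points: a minimizing sequence is Cauchy by the parallelogram
    identity, and its limit has residual orthogonal to the subspace. *)
Lemma nearest_point V x : closed_subspace V ->
  exists2 l, V l & forall v, V v -> ip (x - l) v = 0.
Proof.
move=> cV; pose S := [set ip (x - v) (x - v) | v in V].
have S0 : S !=set0 by exists (ip (x - 0) (x - 0)), 0 => //; exact: subspace0.
have lS : lbound S 0 by move=> _ [v _ <-]; exact: ipxx_ge0.
have hS : has_inf S by split=> //; exists 0.
pose e k : R := k.+1%:R^-1.
have e_gt0 k : 0 < e k by rewrite invr_gt0 ltr0n.
have infS v : V v -> inf S <= ip (x - v) (x - v).
  by move=> Vv; apply: ge_inf; [exists 0|exists v].
have min k : exists v, V v /\ ip (x - v) (x - v) <= inf S + e k ^+ 2.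
  have := inf_adherent (exprn_gt0 2 (e_gt0 k)) hS.
  by case=> _ [v Vv <-] /ltW h; exists v.
have [u uP] := choice min.
have VD v w : V v -> V w -> V (v + w).
  by move=> Vv Vw; rewrite -[v]scale1r; exact: subspaceP.
have VZ r v : V v -> V (rscale r v).
  by move=> Vv; rewrite -[rscale r v]addr0; apply: subspaceP => //; exact: subspace0.
have [//||l ul] := @hilbert_complete _ H u (fun k => 2 * e k).
- by apply: gets_smallM => // [k|]; [exact: ltW|exact: inv_gets_small].
- move=> k m km; apply: (le_nrm_sq hdot); first by rewrite mulr_ge0 // ltW.
  have [Vk hk] := uP k; have [Vm hm] := uP m.
  have em : e m ^+ 2 <= e k ^+ 2.
    have ek j : 0 <= e j by exact: ltW.
    rewrite ler_pXn2r ?nnegrE // /e lef_pV2 ?posrE ?ltr0n //.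
    by rewrite ler_nat.
  have := infS _ (VZ 2^-1 _ (VD _ _ Vk Vm)).
  have -> : x - rscale 2^-1 (u k + u m) =
      rscale 2^-1 ((x - u k) + (x - u m)).
    rewrite addrACA -opprD /rscale scalerBr; congr (_ - _).
    rewrite scalerDr -scalerDl -rmorphD /=.
    have -> : (2^-1 + 2^-1 : R) = 1 by field.
    by rewrite scale1r.
  have -> : u m - u k = (x - u k) - (x - u m) by rewrite opprB [RHS]addrC addrA subrK.
  move: (x - u k) (x - u m) hk hm => w z.
  by rewrite ipZl ipZr !(ipDl, ipDr) !ipNl !ipNr (ipC dot z w); lra.
exists l; first by apply: (subspace_lim cV _ (fun k => (uP k).1) ul);
  apply: gets_smallM => // [k|]; [exact: ltW|exact: inv_gets_small].
suff le v : V v -> ip (x - l) v <= 0.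
  move=> v Vv; apply/eqP; rewrite eq_le le //= -[ip _ v]opprK -ipNr oppr_ge0.
  have -> : - v = rscale (-1) v by rewrite /rscale rmorphN rmorph1 scaleN1r.
  exact/le/VZ.
move=> Vv; apply: (@gets_small_le0 _ e _ (3 * nrm v)); first exact: inv_gets_small.
  by rewrite mulr_ge0 ?nrm_ge0.
move=> k; have [Vk hk] := uP k.
have -> : x - l = (x - u k) - (l - u k) by rewrite opprB addrA subrK.
have h1 : - ip (l - u k) v <= 2 * e k * nrm v.
  rewrite -ipNl (le_trans (cauchy_schwarz hdot _ _)) // nrmN ler_wpM2r ?nrm_ge0 //.
have h2 : ip (x - u k) v <= e k * nrm v.
  (* compare u k with u k + r v for the r that is best for v *)
  have [v0|v0] := eqVneq (nrm v) 0.
    by rewrite (nrm_eq0 v0) ip0r nrm0 mulr0.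
  have vp : 0 < nrm v by rewrite lt_neqAle eq_sym v0 nrm_ge0.
  pose r := ip (x - u k) v / nrm v ^+ 2.
  have := infS _ (VD _ _ Vk (VZ r _ Vv)).
  have -> : x - (u k + rscale r v) = (x - u k) - rscale r v.
    by rewrite opprD addrA.
  move: hk; move: (x - u k) @r => w r hk.
  rewrite !(ipBl dot w, ipBr dot w, ipBr dot _ _ (rscale r v), ipZl, ipZr).
  rewrite (ipC dot v w) (ipxx hdot v) => h.
  have q : ip w v ^+ 2 <= (e k * nrm v) ^+ 2.
    have : r * ip w v <= e k ^+ 2.
      move: h hk; rewrite /r; set a := ip w v.
      have -> : a / nrm v ^+ 2 * (a / nrm v ^+ 2 * nrm v ^+ 2) = a / nrm v ^+ 2 * a.
        by field.
      by lra.
    by rewrite exprMn /r mulrAC ler_pdivrMr ?exprn_gt0 // -expr2.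
  rewrite (le_trans (ler_norm _)) // -(@ler_pXn2r _ 2) ?nnegrE //.
    by rewrite real_normK ?num_real.
  by rewrite mulr_ge0 ?nrm_ge0 // ltW.
by rewrite ipBl; lra.
Qed.

(** The nearest point depends linearly on x because it is characterized by the
    orthogonality of the residual. *)
Lemma orth_proj V : closed_subspace V ->
  exists2 p, is_projection p & forall x, V x <-> p x = x.
Proof.
move=> cV.
have np x : exists l, V l /\ forall v, V v -> ip (x - l) v = 0.
  by have [l] := nearest_point x cV; exists l.
have [p pP] := choice np.
have uniq x l : V l -> (forall v, V v -> ip (x - l) v = 0) -> p x = l.
  move=> Vl lx; have [Vp px] := pP x.
  have Vd : V (p x - l).
    by rewrite addrC -scaleN1r; exact: subspaceP.
  apply/eqP; rewrite -subr_eq0; apply/eqP/(ipxx_eq0 hdot).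
  have e : p x - l = (x - l) - (x - p x) by rewrite opprB [RHS]addrC addrA subrK.
  by rewrite {1}e ipBl lx // px // subrr.
have Vp x : V (p x) by have [] := pP x.
have pid x : V x -> p x = x.
  by move=> Vx; apply: uniq => // v _; rewrite subrr ip0l.
exists p; last by move=> x; split=> [/pid//|<-].
apply: is_projection_intro => [k x y|x|x y].
- apply: uniq => [|v Vv]; first exact: subspaceP.
  have Vk : V (Num.conj k *: v).
    by rewrite -[_ *: v]addr0; apply: subspaceP => //; exact: subspace0.
  rewrite opprD addrACA -scalerBr ipDl (pP y).2 // addr0.
  by rewrite /real_dot dotZl -[k]conjCK -dotZr; exact: (pP x).2.
- exact: pid.
- have h u v : ip u (p v) = ip (p u) (p v).
    by apply/eqP; rewrite -subr_eq0 -ipBl (pP u).2.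
  by rewrite (ipC _ (p x) y) (h y x) (h x y) ipC.
Qed.

(** The squares of the norms of the Q n x decrease, so by Pythagoras the Q n x form
    a Cauchy sequence, whose limit lies in all the ranges. *)
Lemma proj_decr_lim (Q : nat -> H -> H) :
  (forall n, is_projection (Q n)) ->
  (forall n m, (n <= m)%N -> forall x, Q n (Q m x) = Q m x) ->
  exists P, [/\ is_projection P, (forall x, P x = x <-> forall n, Q n x = x)
    & forall x, gets_small (fun n => ip (Q n x) x - ip (P x) x)].
Proof.
move=> pQ decr.
have cV : closed_subspace [set x | forall n, Q n x = x].
  split=> /= [n|k x y hx hy n|u l e e0 hu ul n].
  - by rewrite (lin0 (proj_lin (pQ n))).
  - by rewrite (proj_lin (pQ n)) hx hy.
  apply: (@lim_ext _ _ e u _ _ 1 1) => // k; last by rewrite mul1r.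
  rewrite -[u k in X in nrm X](hu k n) -(linB (proj_lin (pQ n))).
  by rewrite (le_trans (proj_bounded_by (pQ n) _)) // ler_wpM2l.
have [P pP PV] := orth_proj cV.
exists P; split=> // x; first by split=> /PV.
have QP n y : Q n (P y) = P y.
  by have /PV : P (P y) = P y by rewrite proj_idem.
have PQ n y : P (Q n y) = P y by apply: (proj_absorb pP (pQ n)); exact: QP.
have QQ n m y : (n <= m)%N -> Q m (Q n y) = Q m y.
  by move=> nm; apply: (proj_absorb (pQ m) (pQ n)); exact: decr.
pose u n := ip (Q n x) x.
have du n m : (n <= m)%N -> nrm (Q m x - Q n x) ^+ 2 = u n - u m.
  move=> nm; rewrite /u -(ipxx hdot) !(ipBl, ipBr).
  rewrite -!(proj_ip (pQ n)) -!(proj_ip (pQ m)).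
  by rewrite !proj_idem // (QQ n m) // (decr n m) //; ring.
have u0 n : 0 <= u n by rewrite /u proj_form // sqr_ge0.
pose S := [set u n | n in setT].
have S0 : S !=set0 by exists (u 0), 0.
have hS : has_inf S by split=> //; exists 0 => _ [n _ <-].
have infS n : inf S <= u n.
  by apply: ge_inf; [exists 0 => _ [k _ <-]|exists n].
have vS : gets_small (fun n => u n - inf S).
  move=> d d0; have [_ [n _ <-] h] := inf_adherent d0 hS.
  by exists n; rewrite lerBlDl ltW.
pose e n := Num.sqrt (u n - inf S).
have ve : gets_small e.
  move=> d d0; have [n hn] := vS _ (exprn_gt0 2 d0); exists n.
  by rewrite /e -(ger0_norm (ltW d0)) -sqrtr_sqr ler_wsqrtr.
have ee n : e n ^+ 2 = u n - inf S by rewrite sqr_sqrtr // subr_ge0.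
have [|l ul] := hilbert_complete ve (u := fun n => Q n x).
  move=> n m nm; rewrite -(@ler_pXn2r _ 2) ?nnegrE ?nrm_ge0 ?sqrtr_ge0 //.
  by rewrite du // ee lerB.
have de n m : (n <= m)%N -> e m <= e n.
  by move=> nm; rewrite /e ler_wsqrtr // lerD2r -subr_ge0 -du // sqr_ge0.
have Vl n : Q n l = l.
  apply/eqP; rewrite -subr_eq0; apply/eqP/nrm_eq0/eqP.
  rewrite eq_le nrm_ge0 andbT; apply: (gets_small_le0 (C := 2) ve) => // k.
  pose m := maxn n k; rewrite (@le_trans _ _ (2 * e m)) //; last first.
    by rewrite ler_wpM2l // de // leq_maxr.
  have -> : Q n l - l = Q n (l - Q m x) - (l - Q m x).
    by rewrite (linB (proj_lin (pQ n))) decr ?leq_maxl // opprB addrA subrK.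
  rewrite (le_trans (nrmD _ _)) // nrmN mulr2n mulrDl mul1r lerD ?ul //.
  by rewrite (le_trans (proj_bounded_by (pQ n) _)) // mul1r.
have lP : l = P x.
  have /PV <- : forall n, Q n l = l by [].
  apply: (@lim_ext _ _ e (fun k => P (Q k x)) _ _ 1 1) => // k.
    by rewrite -(linB (proj_lin pP)) (le_trans (proj_bounded_by pP _)) // ler_wpM2l.
  by rewrite PQ subrr nrm0 mul1r sqrtr_ge0.
move=> d d0; have d1 : 0 < Num.sqrt d by rewrite sqrtr_gt0.
have [k kd] := ve _ d1; exists k.
have -> : ip (Q k x) x - ip (P x) x = nrm (P x - Q k x) ^+ 2.
  rewrite -(ipxx hdot) !(ipBl, ipBr) -!(proj_ip (pQ k)) -!(proj_ip pP).
  by rewrite QP PQ !proj_idem //; ring.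
rewrite -lP (@le_trans _ _ (Num.sqrt d ^+ 2)) //; last first.
  by rewrite sqr_sqrtr // ltW.
by rewrite ler_pXn2r ?nnegrE ?nrm_ge0 ?sqrtr_ge0 // (le_trans (ul k)).
Qed.

End Projections.

(** * Spectral cuts of a self-adjoint operator *)

Section Cuts.
Variables (R : realType) (H : completeNormedModType R[i]).
Variable dot : {dot H for Num.conj}.
Hypothesis hdot : hilbert_dot dot.
Local Notation ip := (real_dot dot).
Local Notation is_projection := (is_projection dot).

(** The upper inequality is strict on the complement: this makes the cut at s
    unique, equal to the projection for the half-line that is closed at s. *)
Record spectral_cut (b : H -> H) (s : R) (p : H -> H) : Prop := {
  cut_proj : is_projection p;
  cut_comm : forall x, p (b x) = b (p x);
  cut_le : forall x, p x = x -> ip (b x) x <= s * ip x x;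
  cut_gt : forall x, p x = 0 -> x != 0 -> s * ip x x < ip (b x) x }.

Lemma nrm_gt0 (x : H) : x != 0 -> 0 < nrm x.
Proof.
move=> x0; rewrite lt_neqAle nrm_ge0 andbT eq_sym; apply: contra x0.
by move=> /eqP/nrm_eq0->.
Qed.

Lemma bernoulli (r : R) k : 1 <= r -> 1 + k%:R * (r - 1) <= r ^+ k.
Proof.
move=> r1; elim: k => [|k IH]; first by rewrite mul0r addr0 expr0.
rewrite exprS -natr1; have k0 : 0 <= k%:R :> R by [].
move: (k%:R : R) (r ^+ k) IH k0 => u v IH k0.
have h1 : r * (1 + u * (r - 1)) <= r * v by rewrite ler_wpM2l //; lra.
have h2 : 0 <= u * (r - 1) ^+ 2 by rewrite mulr_ge0 ?sqr_ge0.
by lra.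
Qed.

(** The norms of the iterates of a self-adjoint operator are log-convex, so a
    geometric bound on them already holds at the first step. *)
Lemma growth_step (a : H -> H) z (m C : R) : linear a -> self_adjoint dot a ->
  0 < m -> (forall k, nrm (iter k a z) <= C * m ^+ k) -> nrm (a z) <= m * nrm z.
Proof.
move=> la sa m0 gr; rewrite leNgt; apply/negP => big.
have z0 : z != 0.
  by apply/eqP => z0; move: big; rewrite z0 (lin0 la) nrm0 mulr0 ltxx.
have n0 := nrm_gt0 z0.
pose r := nrm (a z) / nrm z.
have rm : m < r by rewrite ltr_pdivlMr.
have step k : 0 < nrm (iter k a z) /\
    r * nrm (iter k a z) <= nrm (iter k.+1 a z).
  elim: k => [|k [k0 IH]] /=; first by rewrite /r divfK ?gt_eqF.
  have k1 : 0 < nrm (a (iter k a z)).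
    by apply: lt_le_trans IH; rewrite mulr_gt0 // (lt_trans m0).
  split=> //; rewrite /= in IH.
  move: k0 k1 IH; set w := iter k a z => k0 k1 IH.
  have : nrm (a w) ^+ 2 <= nrm w * nrm (a (a w)).
    by rewrite -(ipxx hdot) (sa_ip _ _ sa) cauchy_schwarz.
  move: (nrm w) (nrm (a w)) (nrm (a (a w))) k0 k1 IH => A B D A0 B0 IH h.
  rewrite -(ler_pM2l A0); apply: le_trans h.
  by rewrite mulrCA mulrA expr2 ler_pM2r // mulrC.
have pow k : r ^+ k * nrm z <= nrm (iter k a z).
  elim: k => [|k IH]; first by rewrite mul1r.
  have [_ h] := step k; apply: le_trans h.
  by rewrite exprS -mulrA ler_wpM2l // ltW // (lt_trans m0).
have q1 : 1 < r / m by rewrite ltr_pdivlMr // mul1r.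
have bd k : 1 + k%:R * (r / m - 1) <= C / nrm z.
  rewrite (le_trans (bernoulli k (ltW q1))) // ler_pdivlMr //.
  rewrite exprMn mulrAC exprVn ler_pdivrMr ?exprn_gt0 //.
  exact: le_trans (pow k) (gr k).
have C0 : 0 <= C / nrm z by apply: le_trans (bd 0) => //; rewrite mul0r addr0.
have q0 : 0 < r / m - 1 by rewrite subr_gt0.
have := bd (Num.bound (C / nrm z / (r / m - 1))).
have := archi_boundP (divr_ge0 C0 (ltW q0)).
rewrite ltr_pdivrMr //; move: (_%:R * _) => t; lra.
Qed.

Lemma iter_comm (a d : H -> H) k x : (forall y, d (a y) = a (d y)) ->
  d (iter k a x) = iter k a (d x).
Proof. by move=> da; elim: k => //= k IH; rewrite da IH. Qed.

(** If a is at most m on the range of P, then the iterates of a at x in that range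
    grow at most like m ^ k, and this survives the passage to Q (d x) when d and Q
    commute with a; then log-convexity applies to the vector Q (d x). *)
Lemma growth_compress (a d P Q : H -> H) (m K : R) x : linear a ->
  self_adjoint dot a -> 0 < m -> 0 <= K -> bounded_by d K ->
  (forall y, d (a y) = a (d y)) ->
  is_projection P -> (forall y, P (a y) = a (P y)) ->
  is_projection Q -> (forall y, Q (a y) = a (Q y)) ->
  (forall y, P y = y -> 0 <= ip (a y) y <= m * ip y y) -> P x = x ->
  nrm (a (Q (d x))) <= m * nrm (Q (d x)).
Proof.
move=> la sa m0 K0 dK da pP Pa pQ Qa bd Px.
have bP : bounded_by (a \o P) m.
  apply: (psd_bounded_by hdot) => [|||y]; last 1 first.
  - have := bd (P y) (proj_idem pP y).
    rewrite /= -(proj_ip pP) Pa (proj_idem pP) => /andP[-> h] /=.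
    rewrite (le_trans h) // ler_pM2l // !(ipxx hdot) ler_pXn2r ?nnegrE ?nrm_ge0 //.
    by have := proj_bounded_by hdot pP y; rewrite mul1r.
  - exact: lin_comp la (proj_lin pP).
  - by apply: sa_comp => //; [exact: proj_sa|apply/funext => y /=].
  - exact: ltW.
have gr k : P (iter k a x) = iter k a x /\ nrm (iter k a x) <= m ^+ k * nrm x.
  elim: k => [|k [Pk IH]] /=; first by rewrite mul1r.
  split; first by rewrite Pa Pk.
  have := bP (iter k a x); rewrite /= Pk => /le_trans; apply.
  by rewrite exprS -mulrA ler_pM2l.
apply: (@growth_step _ _ _ (K * nrm x)) => // k.
rewrite -(iter_comm _ _ Qa) -(iter_comm _ _ da).
rewrite (le_trans (proj_bounded_by hdot pQ _)) // mul1r (le_trans (dK _)) //.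
by rewrite -mulrA ler_wpM2l // mulrC; have [] := gr k.
Qed.

Section OneOperator.
Variable b : H -> H.
Hypotheses (bb : @bounded_op R H b) (sb : self_adjoint dot b).

Let lb : linear b.
Proof. by case: bb. Qed.

Lemma op_form_bound : exists2 K : R, 0 <= K & forall x, `|ip (b x) x| <= K * ip x x.
Proof.
have /bounded_opP[_ [K K0 bK]] := bb; exists K => // x.
rewrite ler_norml.
have h y : nrm y = nrm x -> ip (b x) y <= K * ip x x.
  move=> yx; rewrite (le_trans (cauchy_schwarz hdot _ _)) // yx (ipxx hdot) expr2 mulrA.
  by rewrite ler_wpM2r ?nrm_ge0.
by rewrite lerNl -ipNr !h ?nrmN.
Qed.

(** Adding a large multiple of the identity makes b positive, so that norms of
    iterates can be compared. *)
Lemma shift_lin K : linear (b + K%:C%C *: idfun).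
Proof. by apply: lin_add => //; apply: lin_scale. Qed.

Lemma shift_sa K : self_adjoint dot (b + K%:C%C *: idfun).
Proof. by apply: saD => //; apply: saZ. Qed.

Lemma shift_ip K x : ip ((b + K%:C%C *: idfun) x) x = ip (b x) x + K * ip x x.
Proof. by rewrite -[(_ + _) x]/(b x + rscale K x) ipDl ipZl. Qed.

Lemma shift_comm K d : linear d -> (forall x, d (b x) = b (d x)) ->
  forall x, d ((b + K%:C%C *: idfun) x) = (b + K%:C%C *: idfun) (d x).
Proof.
move=> ld db x; rewrite -[(b + _) x]/(b x + rscale K x).
by rewrite -[RHS]/(b (d x) + rscale K (d x)) (linD ld) (linR ld) db.
Qed.

(** Take x in the range of p and let z be the component of d x outside of the
    range of p'.  Growth of iterates gives |b z| <= s |z| after shifting b, whereas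
    b > s' >= s strictly at z; hence z = 0. *)
Lemma cut_transfer s s' p p' d K :
  spectral_cut b s p -> spectral_cut b s' p' -> s <= s' ->
  linear d -> 0 <= K -> bounded_by d K -> (forall x, d (b x) = b (d x)) ->
  forall x, p x = x -> p' (d x) = d x.
Proof.
move=> cp cp' ss ld K0 dK db x px.
have [pp pb ple _] := cp; have [pp' pb' _ pgt] := cp'.
have [L L0 bL] := op_form_bound.
pose N := L + `|s| + 1; pose a := b + N%:C%C *: idfun.
have sN : 0 < s + N.
  by rewrite /N; have := ler_norm (- s); rewrite normrN; lra.
have lq := lin_sub (@id_linear R H) (proj_lin pp').
set q := idfun - p' in lq; have pq : is_projection q by exact: proj_compl.
have qb y : q (b y) = b (q y).
  by rewrite -[q _]/(b y - p' (b y)) -[q y]/(y - p' y) (linB lb) pb'.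
have := @growth_compress a d p q (s + N) K x (shift_lin N) (shift_sa N) sN K0 dK
  (shift_comm N ld db) pp (shift_comm N (proj_lin pp) pb) pq
  (shift_comm N lq qb).
have bd y : p y = y -> 0 <= ip (a y) y <= (s + N) * ip y y.
  move=> py; rewrite /a shift_ip; have := ple y py; have := bL y.
  have y0 := ipxx_ge0 hdot y; rewrite ler_norml => /andP[h1 h2] h3.
  apply/andP; split; last by lra.
  rewrite /N; have : 0 <= (`|s| + 1) * ip y y by rewrite mulr_ge0 // addr_ge0.
  by lra.
move=> /(_ bd px); set z := q (d x) => az.
have pz : p' z = 0 by exact: (proj_compl_ker pp').
apply/eqP; rewrite eq_sym -subr_eq0 -/(z); have [//|z0] := eqVneq z 0.
have := pgt z pz z0; have nz := nrm_gt0 z0.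
have := cauchy_schwarz hdot (a z) z; rewrite {1}/a shift_ip (ipxx hdot) => h1 h2.
have h3 : nrm (a z) * nrm z <= (s + N) * nrm z * nrm z by rewrite ler_wpM2r // ltW.
have h4 : (s + N) * nrm z * nrm z <= (s' + N) * nrm z * nrm z.
  by rewrite -!mulrA ler_wpM2r ?mulr_ge0 ?nrm_ge0 // lerD2r.
by lra.
Qed.

(** The case where d is the identity. *)
Lemma cut_mono s s' p p' : spectral_cut b s p -> spectral_cut b s' p' -> s <= s' ->
  forall x, p' (p x) = p x.
Proof.
move=> cp cp' ss x; apply: (cut_transfer (K := 1) (d := idfun) cp cp' ss) => //.
- by move=> y; rewrite mul1r.
- exact: proj_idem (cut_proj cp) x.
Qed.

(** Both off-diagonal corners of d are zero: one by comparing growth of iterates.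
    The same comparison shows that the other corner takes values in the kernel of
    b - s, hence kills the range of b - s, which is dense in the complement. *)
Lemma cut_commute s p d K :
  spectral_cut b s p -> linear d -> 0 <= K -> bounded_by d K ->
  (forall x, d (b x) = b (d x)) -> p \o d = d \o p.
Proof.
move=> cp ld K0 dK db; have [pp pb ple pgt] := cp.
have lp := proj_lin pp.
have c1 x : p (d (p x)) = d (p x).
  by apply: (cut_transfer cp cp (lexx s) ld K0 dK db); exact: (proj_idem pp).
suff c2 x : p x = 0 -> p (d x) = 0.
  apply/funext => x /=; have := c2 (x - p x) (proj_compl_ker pp x).
  by rewrite (linB ld) (linB lp) c1 => /eqP; rewrite subr_eq0 => /eqP.
have [L L0 bL] := op_form_bound.
pose N := L + `|s| + 1; pose a := - b + N%:C%C *: idfun.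
have lN : linear (- b) by exact: lin_opp.
have aE y : a y = rscale N y - b y by rewrite addrC.
have la : linear a by apply: lin_add => //; exact: lin_scale.
have sa : self_adjoint dot a.
  by apply: saD; [exact: saN|exact: saZ].
have a_ip y : ip (a y) y = N * ip y y - ip (b y) y by rewrite aE ipBl ipZl.
have sN : 0 < N - s by rewrite /N; have := ler_norm s; lra.
have a_comm e : linear e -> (forall y, e (b y) = b (e y)) ->
    forall y, e (a y) = a (e y).
  by move=> le eb y; rewrite !aE (linB le) (linR le) eb.
have lq := lin_sub (@id_linear R H) (proj_lin pp).
set q := idfun - p in lq; have pq : is_projection q by exact: proj_compl.
have qE y : q y = y - p y by [].
have qb y : q (b y) = b (q y) by rewrite !qE (linB lb) pb.
have pq0 y : q y = y -> p y = 0.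
  by move=> e; rewrite -e qE (linB lp) (proj_idem pp) subrr.
have qp y : p y = 0 -> q y = y by move=> e; rewrite qE e subr0.
have bd y : q y = y -> 0 <= ip (a y) y <= (N - s) * ip y y.
  move=> qy; rewrite a_ip; have := bL y; have y0 := ipxx_ge0 hdot y.
  rewrite ler_norml => /andP[h1 h2].
  have h3 : s * ip y y <= ip (b y) y.
    have [->|yn0] := eqVneq y 0; first by rewrite !ip0r mulr0.
    by rewrite ltW // pgt // pq0.
  apply/andP; split; last by lra.
  rewrite /N; have : 0 <= (`|s| + 1) * ip y y by rewrite mulr_ge0 // addr_ge0.
  by lra.
have corner y : p y = 0 -> b (p (d y)) = rscale s (p (d y)).
  move=> py.
  have := @growth_compress a d q p (N - s) K y la sa sN K0 dK (a_comm _ ld db)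
    pq (a_comm _ lq qb) pp (a_comm _ lp pb) bd (qp _ py).
  set z := p (d y) => az; have pz : p z = z by exact: (proj_idem pp).
  have h := ple z pz; have e := a_ip z.
  apply/eqP; rewrite -subr_eq0; apply/eqP/(ipxx_le0 hdot).
  have -> : b z - rscale s z = rscale (N - s) z - a z.
    have -> : rscale (N - s) z = rscale N z - rscale s z.
      by rewrite /rscale rmorphB scalerBl.
    by rewrite aE opprB [RHS]addrC addrA subrK.
  rewrite !(ipBl, ipBr) !(ipZl, ipZr) (ipC dot z (a z)) e !(ipxx hdot).
  have sq : nrm (a z) ^+ 2 <= ((N - s) * nrm z) ^+ 2.
    by rewrite ler_pXn2r ?nnegrE ?mulr_ge0 ?nrm_ge0 // ltW.
  by rewrite !(ipxx hdot) in h *; nra.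
(* the kernel of the corner contains the range of b - s; a vector of the
   complement orthogonal to this kernel is zero because b > s there *)
pose D := p \o d \o q.
have lD : linear D by apply: lin_comp => //; exact: lin_comp.
have bD : bounded_by D K.
  move=> y; rewrite (le_trans (proj_bounded_by hdot pp _)) // mul1r.
  rewrite (le_trans (dK _)) // ler_wpM2l //.
  by have := proj_bounded_by hdot pq y; rewrite mul1r.
have [P pP PV] := orth_proj hdot (subspace_ker lD K0 bD).
move=> px; pose w := x - P x.
have orth v : D v = 0 -> ip w v = 0.
  move=> /PV Pv; rewrite -Pv -(proj_ip pP).
  by rewrite /w (proj_compl_ker pP) ip0l.
have Dp v : D (p v) = 0.
  by rewrite /D /= qE (proj_idem pp) subrr (lin0 ld) (lin0 lp).
have pw : p w = 0.
  apply: (ipxx_eq0 hdot); rewrite (proj_ip pp) (proj_idem pp).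
  exact: orth (Dp w).
have [w0|w0] := eqVneq w 0.
  have : D (P x) = 0 by apply/PV; exact: (proj_idem pP).
  have -> : P x = x by apply/eqP; rewrite eq_sym -subr_eq0 -/w w0.
  by rewrite /D /= qp.
exfalso; have := pgt w pw w0; have := orth (b w - rscale s w).
rewrite (linB lD) (linR lD) /D /= qb (qp _ pw) db pb corner // subrr => /(_ erefl).
by rewrite ipBr ipZr (ipC _ w (b w)); lra.
Qed.

(** The cut at s is the projection on the kernel of |c| + c, with c = b - s. *)
Lemma cut_exists s : exists p, spectral_cut b s p.
Proof.
have /bounded_opP[_ [L L0 bL]] := bb.
pose c := b + (- s)%:C%C *: idfun.
have lc : linear c by exact: shift_lin.
have sc : self_adjoint dot c by exact: shift_sa.
have cE x : c x = b x - rscale s x.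
  by rewrite -[c x]/(b x + rscale (- s) x) /rscale rmorphN scaleNr.
clearbody c.
pose K := L + `|s| + 1; have K0 : 0 < K by rewrite ltr_wpDl ?addr_ge0.
have bc : bounded_by c K.
  move=> x; rewrite cE (le_trans (nrmD _ _)) // nrmN nrmZ.
  rewrite /K !mulrDl mul1r -addrA lerD ?bL // lerDl nrm_ge0 //.
(* rescaled to lie below the identity *)
pose T := (K ^- 2)%:C%C *: (c \o c).
have TE x : T x = rscale (K ^- 2) (c (c x)) by [].
have lT : linear T by apply: lin_scale; exact: lin_comp.
have sT : self_adjoint dot T by apply: saZ; exact: sa_comp.
have T01 x : 0 <= ip (T x) x <= ip x x.
  rewrite TE ipZl (sa_ip _ _ sc) !(ipxx hdot) mulr_ge0 ?invr_ge0 ?sqr_ge0 //=.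
  rewrite mulrC ler_pdivrMr ?exprn_gt0 // -exprMn mulrC.
  by rewrite ler_pXn2r ?nnegrE ?mulr_ge0 ?nrm_ge0 ?(ltW K0).
have [r [[lr br] sr pr rT rcomm]] := psd_sqrt hdot lT sT T01.
pose A := K%:C%C *: r.
have AE x : A x = rscale K (r x) by [].
have lA : linear A by exact: lin_scale.
have sA : self_adjoint dot A by exact: saZ.
clearbody A.
have pA x : 0 <= ip (A x) x by rewrite AE ipZl mulr_ge0 // ltW.
have AA x : A (A x) = c (c x).
  have -> : c (c x) = rscale (K ^+ 2) (T x).
    by rewrite TE /rscale scalerA -rmorphM mulfV ?scale1r // expf_neq0 // gt_eqF.
  by rewrite -rT !AE (linR lr) /rscale scalerA -rmorphM -expr2.
have comm d k : linear d -> 0 <= k -> bounded_by d k -> (forall x, d (c x) = c (d x)) ->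
    forall x, d (A x) = A (d x).
  move=> ld k0 dk dc x; rewrite !AE (linR ld); congr (rscale _ _).
  have /(congr1 (fun f => f x)) : d \o r = r \o d; last by [].
  apply: (rcomm d k) => //; apply/funext => y /=.
  by rewrite !TE (linR ld) !dc.
have cA x : c (A x) = A (c x) by apply: (comm c K) => //; exact: ltW.
pose N := A + c; have NE x : N x = A x + c x by [].
have lN : linear N by exact: lin_add.
clearbody N.
have bN : bounded_by N (K * 2 + K).
  move=> x; rewrite NE (le_trans (nrmD _ _)) // mulrDl lerD //.
  by rewrite AE nrmZ gtr0_norm // -mulrA ler_pM2l.
have N0 : 0 <= K * 2 + K by lra.
have [p pp pN] := orth_proj hdot (subspace_ker lN N0 bN).
have pN0 x : p x = x -> N x = 0 by move/pN.
have Nc x : N (c x) = c (N x) by rewrite (NE (c x)) (NE x) (linD lc) (cA x).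
have NA x : N (A x) = A (N x) by rewrite (NE (A x)) (NE x) (linD lA) (cA x).
have pc : p \o c = c \o p.
  apply: (proj_comm hdot pp lc sc) => x /pN0 Nx; apply/pN.
  by rewrite /= Nc Nx (lin0 lc).
have pb x : p (b x) = b (p x).
  have bE y : b y = c y + rscale s y by rewrite cE subrK.
  rewrite !bE (linD (proj_lin pp)) (linR (proj_lin pp)); congr (_ + _).
  exact: (congr1 (fun f => f x) pc).
have c_ip x : ip (c x) x = ip (b x) x - s * ip x x by rewrite cE ipBl ipZl.
exists p; split=> // x.
  move=> /pN0; rewrite NE => /eqP; rewrite addrC addr_eq0 => /eqP cx.
  by have := c_ip x; rewrite cx ipNl; have := pA x; lra.
move=> px x0; pose M := A - c.
have ME y : M y = A y - c y by [].
have lM : linear M by exact: lin_sub.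
have sM : self_adjoint dot M by exact: saB.
(* (|c| + c) (|c| - c) = 0, so c = |c| on the complement of the kernel *)
have NM y : N (M y) = 0.
  by rewrite ME (linB lN) NA Nc !NE (linD lA) (linD lc) AA cA (addrC (c (c y))) subrr.
have Mx : M x = 0.
  apply: (ipxx_eq0 hdot); rewrite (sa_ip _ _ sM).
  have /pN <- : [set y | N y = 0] (M (M x)) by exact: NM.
  by rewrite -(proj_ip pp) px ip0l.
have cx : c x = A x by apply/eqP; rewrite eq_sym -subr_eq0 -ME Mx.
rewrite ltNge; apply/negP => h.
have Ax : A x = 0.
  by apply: (psd_ker hdot lA sA pA); rewrite -cx c_ip; lra.
have /pN : N x = 0 by rewrite NE cx Ax addr0.
by rewrite px => /esym/eqP; apply/negP.
Qed.

End OneOperator.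
End Cuts.

(** * Stieltjes measures of finite mass *)

Section Stieltjes.
Variable R : realType.

Section OneFunction.
Variable F : R -> R.
Hypothesis F_nd : nondecreasing F.
Hypothesis F_rc : forall x d, 0 < d -> exists2 y, x < y & F y - F x <= d.

Let F_rcont : right_continuous F.
Proof.
move=> x; apply/cvgrPdist_le => e e0.
have [y xy Fy] := F_rc x e0.
near=> z; have xz : x < z by near: z; exact: nbhs_right_gt.
have zy : z <= y by near: z; exact: nbhs_right_le.
rewrite distrC ger0_norm ?subr_ge0; last by apply: F_nd; exact: ltW.
by apply: le_trans Fy; rewrite lerD2r; exact: F_nd.
Unshelve. all: by end_near. Qed.

HB.instance Definition _ := isCumulative.Build R _ R F F_nd F_rcont.

Let lsF := lebesgue_stieltjes_measure F.

Let lsF_itv a b : a <= b -> lsF `]a, b]%classic = (F b - F a)%:E.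
Proof.
move=> ab; rewrite /lsF /lebesgue_stieltjes_measure /measure_extension /=.
by rewrite measurable_mu_extE/= ?wlength_itv_bnd//; exact: is_ocitv.
Qed.

(* the same function on the Borel sets of R, whose measurable structure is
   declared separately from that of the Stieltjes construction *)
Let lsR (A : set R) : \bar R := lsF A.

Let lsR0 : lsR set0 = 0%E. Proof. exact: (@measure0 _ _ _ lsF). Qed.

Let lsR_ge0 A : (0 <= lsR A)%E. Proof. exact: measure_ge0. Qed.

Let lsR_sigma : semi_sigma_additive lsR.
Proof. exact: (@measure_semi_sigma_additive _ _ _ lsF). Qed.

HB.instance Definition _ := isMeasure.Build _ R R lsR lsR0 lsR_ge0 lsR_sigma.

Lemma stieltjes_exists : exists mu : {measure set R -> \bar R},
  forall a b, a <= b -> mu `]a, b]%classic = (F b - F a)%:E.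
Proof. by exists lsR. Qed.
End OneFunction.

(** The mass is read off on intervals that exhaust the line: the increment of F
    over each of them is already m. *)
Lemma stieltjes_finite (F : R -> R) L m : 0 <= L -> nondecreasing F ->
  (forall x d, 0 < d -> exists2 y, x < y & F y - F x <= d) ->
  (forall x, x < - L -> F x = 0) -> (forall x, L <= x -> F x = m) ->
  exists mu : {measure set R -> \bar R},
  (forall a b, a <= b -> mu `]a, b]%classic = (F b - F a)%:E) /\ mu setT = m%:E.
Proof.
move=> L0 nd rc Fl Fr; have [mu muE] := stieltjes_exists nd rc.
exists mu; split=> //.
pose I n : set R := `]- (L + 1 + n%:R), (L + 1 + n%:R)]%classic.
have IE n : mu (I n) = m%:E.
  have n0 : 0 <= n%:R :> R by [].
  have F1 : F (L + 1 + n%:R) = m by apply: Fr; lra.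
  have F0 : F (- (L + 1 + n%:R)) = 0 by apply: Fl; lra.
  by rewrite muE ?F1 ?F0 ?subr0 //; lra.
have IT : \bigcup_n I n = setT.
  rewrite -subTset => x _; exists (Num.bound `|x|) => //=.
  have := archi_boundP (normr_ge0 x); rewrite ltr_norml /I /= => /andP[h1 h2].
  rewrite in_itv /=.
  by apply/andP; split; lra.
have : (mu \o I) n @[n --> \oo] --> mu (\bigcup_n I n).
  apply: nondecreasing_cvg_mu; rewrite /I//; first exact: bigcup_measurable.
  move=> i j ij; apply/subsetPset/subset_itv; rewrite bnd_simp.
    by rewrite lerN2 lerD2l ler_nat.
  by rewrite lerD2l ler_nat.
have -> : mu \o I = cst m%:E by apply/funext => n /=; rewrite IE.
by rewrite IT => h; apply: (cvg_unique _ h); [|exact: cvg_cst].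
Qed.
End Stieltjes.

(** * Projection-valued measures from scalar ones *)

Section SpectralMeasureSets.
Variables (R : realType) (H : completeNormedModType R[i]).
Variable dot : {dot H for Num.conj}.
Hypothesis hdot : hilbert_dot dot.
Local Notation ip := (real_dot dot).
Local Notation is_projection := (is_projection dot).

Lemma proj_form_ext P Q : is_projection P -> is_projection Q ->
  (forall x, ip (P x) x = ip (Q x) x) -> P = Q.
Proof.
move=> pP pQ; apply: (sa_ext hdot).
- exact: proj_lin pP.
- exact: proj_lin pQ.
- exact: proj_sa pP.
- exact: proj_sa pQ.
Qed.

(** P + Q <= 1 forces the ranges to be orthogonal. *)
Lemma proj_sum P Q : is_projection P -> is_projection Q ->
  (forall x, ip (P x) x + ip (Q x) x <= ip x x) ->
  is_projection (P + Q) /\ forall x, Q (P x) = 0.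
Proof.
move=> pP pQ le.
have orth A B : is_projection A -> is_projection B ->
    (forall x, ip (A x) x + ip (B x) x <= ip x x) -> forall x, B (A x) = 0.
  move=> pA pB h x; have := h (A x); rewrite (proj_idem pA) => {}h.
  apply/nrm_eq0/eqP; rewrite -sqrf_eq0 eq_le sqr_ge0 andbT -(proj_form hdot pB).
  by move: h; lra.
have QP := orth P Q pP pQ le.
have PQ : forall x, P (Q x) = 0.
  by apply: orth => // x; rewrite addrC.
split=> //; apply: is_projection_intro => //.
- by apply: lin_add; [exact: proj_lin pP|exact: proj_lin pQ].
- move=> x; rewrite -[(P + Q) x]/(P x + Q x).
  rewrite -[LHS]/(P (P x + Q x) + Q (P x + Q x)).
  rewrite (linD (proj_lin pP)) (linD (proj_lin pQ)) QP PQ.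
  by rewrite (proj_idem pP) (proj_idem pQ) addr0 add0r.
- move=> x y; rewrite -[(P + Q) x]/(P x + Q x) -[(P + Q) y]/(P y + Q y).
  by rewrite ipDl ipDr (proj_ip pP) (proj_ip pQ).
Qed.

Variable mu : H -> {measure set R -> \bar R}.
Hypothesis muT : forall x, mu x setT = (ip x x)%:E.

(** The measures of a projection-valued measure determine it: P is its value at A
    when the form of P is the measure of A at every vector. *)
Definition represents (A : set R) (P : H -> H) :=
  is_projection P /\ forall x, mu x A = (ip (P x) x)%:E.

Lemma represents_uniq A P Q : represents A P -> represents A Q -> P = Q.
Proof.
move=> [pP hP] [pQ hQ]; apply: proj_form_ext => // x.
by have := hP x; rewrite hQ => -[].
Qed.

Lemma represents0 : represents set0 0.
Proof. by split=> [|x]; [exact: proj0|rewrite measure0 ip0l]. Qed.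

Lemma representsT : represents setT idfun.
Proof. by split=> [|x]; [exact: proj1|rewrite muT]. Qed.

Lemma representsU A B P Q : measurable A -> measurable B -> A `&` B = set0 ->
  represents A P -> represents B Q -> represents (A `|` B) (P + Q).
Proof.
move=> mA mB AB [pP hP] [pQ hQ].
have e x : mu x (A `|` B) = (ip (P x) x + ip (Q x) x)%:E.
  by rewrite measureU // EFinD -hP -hQ.
split; last by move=> x; rewrite e -[(P + Q) x]/(P x + Q x) ipDl.
have [] // := proj_sum pP pQ => x; rewrite -lee_fin -e -muT.
by apply: le_measure; rewrite ?inE //; exact: measurableU.
Qed.

Lemma represents_disj A B P Q : measurable A -> measurable B -> A `&` B = set0 ->
  represents A P -> represents B Q -> forall x, Q (P x) = 0.
Proof.
move=> mA mB AB rA rB; have [_ e] := representsU mA mB AB rA rB.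
have [pP hP] := rA; have [pQ hQ] := rB.
have [] // := proj_sum pP pQ => x.
have -> : ip (P x) x + ip (Q x) x = ip ((P + Q) x) x.
  by rewrite -[(P + Q) x]/(P x + Q x) ipDl.
rewrite -lee_fin -e -muT.
by apply: le_measure; rewrite ?inE //; exact: measurableU.
Qed.

Lemma represents_le A B P Q : measurable A -> measurable B -> A `<=` B ->
  represents A P -> represents B Q -> forall x, ip (P x) x <= ip (Q x) x.
Proof.
move=> mA mB AB [_ hP] [_ hQ] x; rewrite -lee_fin -hP -hQ.
by apply: le_measure; rewrite ?inE.
Qed.

Lemma representsC A P : measurable A -> represents A P ->
  represents (~` A) (idfun - P).
Proof.
move=> mA [pP hP]; split=> [|x]; first exact: proj_compl.
have mC := measurableC mA.
have : (mu x A + mu x (~` A))%E = (ip x x)%:E.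
  by rewrite -muT -(setUv A) measureU ?setICr.
rewrite hP -[(idfun - P) x]/(x - P x) ipBl.
case: (mu x (~` A)) => [r| |] //= [<-].
by congr EFin; ring.
Qed.

(** Countable additivity on the level of projections: the partial unions are
    represented by increasing projections, which converge strongly. *)
Lemma represents_bigcup (F : (set R)^nat) : (forall n, measurable (F n)) ->
  trivIset [set: nat] F -> (forall n, exists P, represents (F n) P) ->
  exists P, represents (\bigcup_k F k) P.
Proof.
move=> mF tF rF.
pose U n := \big[setU/set0]_(i < n) F i.
have mU n : measurable (U n) by exact: bigsetU_measurable.
have UI n : U n `&` F n = set0.
  rewrite -subset0 => y []; rewrite /U -bigcup_mkord => -[i /= ilt Fi] Fn.
  have ni : i = n by apply: tF => //; exists y.
  by rewrite ni ltnn in ilt.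
have rU n : exists P, represents (U n) P.
  elim: n => [|n [P rP]]; first by exists 0; rewrite /U big_ord0; exact: represents0.
  have [Q rQ] := rF n; exists (P + Q).
  rewrite /U big_ord_recr /=; exact: (representsU (mU n) (mF n) (UI n)).
have [S rS] := choice rU.
have nU n m : (n <= m)%N -> U n `<=` U m.
  by move=> nm; exact: subset_bigsetU.
have pS n : is_projection (S n) by have [] := rS n.
pose Q n := idfun - S n.
have QE n x : Q n x = x - S n x by [].
have pQ n : is_projection (Q n) by exact: proj_compl.
have decr n m : (n <= m)%N -> forall x, Q n (Q m x) = Q m x.
  move=> nm; apply: (range_incl hdot) => // x; rewrite !QE !ipBl lerD2l lerN2.
  by apply: represents_le (rS n) (rS m) x => //; exact: nU.
have [P [pP PQ vP]] := proj_decr_lim hdot pQ decr.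
exists (idfun - P); split=> [|x]; first exact: proj_compl.
have -> : (idfun - P) x = x - P x by [].
have US : \bigcup_k F k = \bigcup_k U k.
  apply/seteqP; split=> y [k _ yk].
    by exists k.+1 => //; rewrite /U big_ord_recr /=; right.
  by move: yk; rewrite /U -bigcup_mkord => -[i _ Fi]; exists i.
have cv : (mu x \o U) n @[n --> \oo] --> mu x (\bigcup_k U k).
  apply: nondecreasing_cvg_mu => //; first exact: bigcup_measurable.
  by move=> n m nm; apply/subsetPset; exact: nU.
have e n : mu x (U n) = (ip (S n x) x)%:E by have [_] := rS n.
have le n : ip (S n x) x <= ip (x - P x) x.
  rewrite ipBl; have h : ip (P x) x <= ip (Q n x) x.
    rewrite (proj_form hdot pP) (proj_form hdot (pQ n)).
    have -> : P x = P (Q n x).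
      have QP y : Q n (P y) = P y by apply: (PQ _).1; exact: (proj_idem pP).
      by rewrite (proj_absorb hdot pP (pQ n) QP).
    rewrite ler_pXn2r ?nnegrE ?nrm_ge0 //.
    by have := proj_bounded_by hdot pP (Q n x); rewrite mul1r.
  by move: h; rewrite QE ipBl; lra.
have le_mu n : ((ip (S n x) x)%:E <= mu x (\bigcup_k U k))%E.
  by rewrite -e; apply: le_measure; rewrite ?inE //;
    [exact: bigcup_measurable|exact: bigcup_sup].
rewrite US; apply/eqP; rewrite eq_le; apply/andP; split.
  rewrite -(cvg_lim _ cv) //; apply: lime_le.
    by apply/cvg_ex; exists (mu x (\bigcup_k U k)).
  by apply: nearW => n; rewrite /= e lee_fin.
apply/lee_addgt0Pr => d d0; have [n hn] := vP x d d0.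
apply: (@le_trans _ _ ((ip (S n x) x)%:E + d%:E)%E); last by rewrite leeD2r.
by rewrite -EFinD lee_fin; move: hn; rewrite QE !ipBl; lra.
Qed.

Hypothesis mu_itv : forall a b, exists P, represents `]a, b]%classic P.

(** The sets with a representing projection contain the half-open intervals and
    are stable under complements and disjoint countable unions. *)
Lemma represents_exists A : measurable A -> exists P, represents A P.
Proof.
move: A; apply: (@dynkin_induction _ R (@ocitv R)) => //.
- exact: ocitvI.
- by exists idfun; exact: representsT.
- by move=> _ [[a b] _ <-] /=; exact: mu_itv.
- by move=> S mS [P rP]; exists (idfun - P); exact: representsC.
- by move=> F mF tF rF; exact: represents_bigcup.
Qed.

(** Multiplicativity comes for free: disjoint sets have orthogonal projections, and
    E A = E (A `&` B) + E (A `\` B). *)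
Lemma represents_family : exists E : set R -> H -> H,
  [/\ forall A, measurable A -> represents A (E A), E setT = idfun
    & forall A B, measurable A -> measurable B -> E (A `&` B) = E A \o E B].
Proof.
have ex A : exists P, measurable A -> represents A P.
  have [mA|nA] := pselect (measurable A); last by exists 0.
  by have [P rP] := represents_exists mA; exists P.
have [E rE] := choice ex; exists E; split=> //.
  exact: represents_uniq (rE _ measurableT) representsT.
move=> A B mA mB; apply/funext => x /=.
have mI : measurable (A `&` B) by exact: measurableI.
have mD : measurable (A `\` B) by exact: measurableD.
have split_A : E A = E (A `&` B) + E (A `\` B).
  apply: represents_uniq (rE A mA) _; rewrite -{1}(setUIDK A B).
  apply: representsU => //; last 2 first.
  - exact: rE.
  - exact: rE.
  by rewrite -subset0 => y [[_ +] [_ +]].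
rewrite split_A -[RHS]/(E (A `&` B) (E B x) + E (A `\` B) (E B x)).
rewrite (represents_disj mB mD _ (rE _ mB) (rE _ mD)) ?addr0; last first.
  by rewrite -subset0 => y [+ [_ +]].
have [pI _] := rE _ mI; have [pB _] := rE _ mB.
rewrite (proj_absorb hdot pI pB) //; apply: (range_incl hdot pI pB).
by apply: represents_le (rE _ mI) (rE _ mB).
Qed.

End SpectralMeasureSets.

(** * The spectral theorem *)

Section SpectralTheorem.
Variables (R : realType) (H : completeNormedModType R[i]).
Variable dot : {dot H for Num.conj}.
Hypothesis hdot : hilbert_dot dot.
Local Notation ip := (real_dot dot).
Local Notation is_projection := (is_projection dot).

(** Cut the segment into n equal pieces: the increments of Phi add up to at most
    the mesh times the total increment of F. *)
Lemma small_increments (Phi F : R -> R) a c : a <= c ->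
  (forall s t, a <= s -> s <= t -> t <= c ->
    `|Phi t - Phi s| <= (t - s) * (F t - F s)) -> Phi c = Phi a.
Proof.
move=> ac inc.
have FF : 0 <= (c - a) * (F c - F a) by apply: le_trans (inc a c _ _ _).
apply/eqP; rewrite -subr_eq0 -normr_eq0 eq_le normr_ge0 andbT.
apply: (gets_small_le0 (@inv_gets_small R) FF) => n.
pose d := (c - a) / n.+1%:R.
have n0 : 0 < n.+1%:R :> R by rewrite ltr0n.
have d0 : 0 <= d by rewrite divr_ge0 ?subr_ge0 // ltW.
have cE : c = a + n.+1%:R * d by rewrite /d mulrC divfK ?gt_eqF // addrC subrK.
have step i : (i <= n.+1)%N ->
    `|Phi (a + i%:R * d) - Phi a| <= d * (F (a + i%:R * d) - F a).
  elim: i => [_|i IH ile]; first by rewrite mul0r addr0 !subrr normr0 mulr0.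
  set s := a + i%:R * d; set t := a + i.+1%:R * d.
  have ts : t - s = d by rewrite /t /s -natr1; ring.
  have as_ : a <= s by rewrite lerDl mulr_ge0.
  have tc : t <= c by rewrite cE lerD2l ler_wpM2r // ler_nat.
  have st : s <= t by rewrite -subr_ge0 ts.
  have -> : Phi t - Phi a = (Phi t - Phi s) + (Phi s - Phi a) by rewrite addrA subrK.
  rewrite (le_trans (ler_normD _ _)) //.
  have h1 := inc s t as_ st tc; have h2 := IH (ltnW ile).
  by rewrite ts in h1; move: h1 h2; rewrite -/s; nra.
have := step n.+1 (leqnn _); rewrite -cE => /le_trans; apply.
by rewrite /d mulrAC.
Qed.

Variable b : H -> H.
Hypotheses (bb : @bounded_op R H b) (sb : self_adjoint dot b).

Let lb : linear b.
Proof. by case: bb. Qed.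

Lemma cut_bot s p L :
  spectral_cut dot b s p -> (forall x, `|ip (b x) x| <= L * ip x x) ->
  s < - L -> forall x, p x = 0.
Proof.
move=> [pp _ ple _] bL sL x; apply: (ipxx_le0 hdot).
have := ple _ (proj_idem pp x); have := bL (p x); rewrite ler_norml => /andP[h _].
have := ipxx_ge0 hdot (p x); move: (ip (p x) (p x)) h => t; nra.
Qed.

Lemma cut_top s p L :
  spectral_cut dot b s p -> (forall x, `|ip (b x) x| <= L * ip x x) ->
  L <= s -> forall x, p x = x.
Proof.
move=> [pp _ _ pgt] bL sL x; apply/eqP; rewrite eq_sym -subr_eq0.
have [//|n0] := eqVneq (x - p x) 0.
have := pgt _ (proj_compl_ker pp x) n0.
have := bL (x - p x); rewrite ler_norml => /andP[_ h].
have := ipxx_ge0 hdot (x - p x); move: (x - p x) h => y h1 h2 h3.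
have : L * ip y y <= s * ip y y by rewrite ler_wpM2r.
by lra.
Qed.

Section Family.
Variable p : R -> H -> H.
Hypothesis cp : forall s, spectral_cut dot b s (p s).

Let pp s : is_projection (p s). Proof. by case: (cp s). Qed.

Let up s t x : s <= t -> p t (p s x) = p s x.
Proof. by move=> st; exact: (cut_mono hdot bb sb (cp s) (cp t) st). Qed.

Let down s t x : s <= t -> p s (p t x) = p s x.
Proof. by move=> st; apply: (proj_absorb hdot (pp s) (pp t)) => y; exact: up. Qed.

Lemma cut_form_mono x : nondecreasing (fun s => ip (p s x) x).
Proof.
move=> s t st /=; rewrite !(proj_form hdot (pp _)) -(down x st).
rewrite ler_pXn2r ?nnegrE ?nrm_ge0 //.
by have := proj_bounded_by hdot (pp s) (p t x); rewrite mul1r.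
Qed.

(** The strict inequality in the notion of cut makes the family right-continuous. *)
Lemma cut_form_rc x s d : 0 < d ->
  exists2 t, s < t & ip (p t x) x - ip (p s x) x <= d.
Proof.
move=> d0; pose u n : R := s + n.+1%:R^-1.
have su n : s < u n by rewrite ltrDl invr_gt0 ltr0n.
have decr n m : (n <= m)%N -> forall x, p (u n) (p (u m) x) = p (u m) x.
  move=> nm y; apply: up; rewrite lerD2l lef_pV2 ?posrE ?ltr0n //.
  by rewrite ler_nat.
have [P [pP PQ vP]] := proj_decr_lim hdot (fun n => pp (u n)) decr.
have sP y : p s (P y) = P y.
  have QPy n : p (u n) (P y) = P y by apply: (PQ _).1; exact: (proj_idem pP).
  set z := P y - p s (P y).
  have pz : p s z = 0 by exact: (proj_compl_ker (pp s)).
  have Qz n : p (u n) z = z.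
    by rewrite (linB (proj_lin (pp _))) QPy up // ltW.
  have le : ip (b z) z - s * ip z z <= 0.
    apply: (gets_small_le0 (@inv_gets_small R) (ipxx_ge0 hdot z)) => n.
    have := cut_le (cp (u n)) (Qz n); rewrite /u; move: (n.+1%:R^-1) => r.
    by rewrite mulrDl; lra.
  apply/eqP; rewrite eq_sym -subr_eq0 -/z; have [//|z0] := eqVneq z 0.
  by have := cut_gt (cp s) pz z0; lra.
have [n hn] := vP x d d0; exists (u n) => //.
apply: le_trans hn; rewrite lerD2l lerN2 (proj_form hdot pP) (proj_form hdot (pp s)).
rewrite -(proj_absorb hdot pP (pp s) sP).
rewrite ler_pXn2r ?nnegrE ?nrm_ge0 //.
by have := proj_bounded_by hdot pP (p s x); rewrite mul1r.
Qed.

Lemma cut_diff_proj s t : s <= t -> is_projection (p t - p s).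
Proof.
move=> st; have E x : (p t - p s) x = p t x - p s x by [].
apply: (is_projection_intro hdot) => [|x|x y].
- by apply: lin_sub; exact: proj_lin (pp _).
- rewrite !E !(linB (proj_lin (pp _))) (proj_idem (pp t)) (proj_idem (pp s)).
  by rewrite (up x st) (down x st) subrr subr0.
- by rewrite !E ipBl ipBr !(proj_ip (pp _)).
Qed.

(** Since b has no cross term between y = p_t x - p_s x and p_s x, the difference B
    is the form of b at y, where both cut inequalities apply. *)
Lemma cut_slice s t x : s <= t ->
  let D := ip (p t x) x - ip (p s x) x in
  let B := ip (b (p t x)) (p t x) - ip (b (p s x)) (p s x) in
  s * D <= B <= t * D.
Proof.
move=> st /=; set y := p t x - p s x.
have ty : p t y = y.
  by rewrite /y (linB (proj_lin (pp t))) (proj_idem (pp t)) (up x st).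
have sy : p s y = 0.
  by rewrite /y (linB (proj_lin (pp s))) (proj_idem (pp s)) (down x st) subrr.
have -> : ip (p t x) x - ip (p s x) x = ip y y.
  rewrite /y !(ipBl, ipBr) -!(proj_ip (pp t)) -!(proj_ip (pp s)).
  by rewrite (proj_idem (pp t)) (proj_idem (pp s)) (up x st) (down x st); ring.
have tx : p t x = y + p s x by rewrite subrK.
clearbody y.
have -> : ip (b (p t x)) (p t x) - ip (b (p s x)) (p s x) = ip (b y) y.
  have z1 : ip (b (p s x)) y = 0.
    rewrite -(proj_idem (pp s)) -(cut_comm (cp s)) (proj_ip (pp s)) sy.
    by rewrite ip0r.
  have z2 : ip (b y) (p s x) = 0 by rewrite (sa_ip _ _ sb) ipC.
  by rewrite tx (linD lb) !(ipDl, ipDr) z1 z2; ring.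
apply/andP; split; last exact: (cut_le (cp t) ty).
have [->|y0] := eqVneq y 0; first by rewrite !ip0r mulr0.
exact/ltW/(cut_gt (cp s) sy y0).
Qed.

(** On each slice ]s, t] both the integral of the identity and the form of b lie
    between s and t times the mass, so the two agree up to small increments. *)
Lemma spectral_integral (x : H) (L : R) (mu : {measure set R -> \bar R}) : 0 <= L ->
  (forall x, `|ip (b x) x| <= L * ip x x) -> mu setT = (ip x x)%:E ->
  (forall s t, s <= t -> mu `]s, t]%classic = (ip (p t x) x - ip (p s x) x)%:E) ->
  mu.-integrable setT (fun l : R => l%:E) /\
  (\int[mu]_l l%:E)%E = (ip (b x) x)%:E.
Proof.
move=> L0 bL muT muI; pose K := L + 1.
have K0 : - K <= K by rewrite /K; lra.
have ptop : p K x = x by apply: (cut_top (cp K) bL); rewrite /K; lra.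
have pbot : p (- K) x = 0 by apply: (cut_bot (cp (- K)) bL); rewrite /K; lra.
pose D := `]- K, K]%classic : set R.
have mD : measurable D by exact: measurable_itv.
have muD : mu D = (ip x x)%:E by rewrite muI // ptop pbot ip0l subr0.
have muN : mu (~` D) = 0%E.
  have e : (mu D + mu (~` D))%E = (ip x x)%:E.
    by rewrite -muT -(setUv D) measureU ?setICr //; exact: measurableC.
  by rewrite muD in e; case: (mu (~` D)) e => [r| |] //= [] h; congr EFin; lra.
have mid (A : set R) : measurable_fun A (fun l : R => l) by exact: measurable_id.
have iD : mu.-integrable D (EFin \o (fun l : R => l)).
  apply: measurable_bounded_integrable => //; first by rewrite muD ltry.
  exists K; split; first by rewrite num_real.
  move=> M KM l; rewrite /D /= in_itv /= => /andP[h1 h2].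
  by rewrite ler_norml; apply/andP; split; lra.
have iT : mu.-integrable setT (fun l : R => l%:E).
  apply/(negligible_integrable _ _ _ muN) => //; first exact: measurableC.
    exact/measurable_realfun.measurable_EFinP.
  by rewrite setTD setCK.
split=> //.
rewrite (negligible_integral _ measurableT iT muN) ?setTD ?setCK; last first.
  exact: measurableC.
pose G s := \int[mu]_(l in `]- K, s]) l.
have iS A : measurable A -> A `<=` D -> mu.-integrable A (EFin \o (fun l : R => l)).
  by move=> mA AD; exact: integrableS iD.
have Gfin : (\int[mu]_(l in D) l%:E)%E = (G K)%:E.
  by rewrite /G /Rintegral fineK //; apply: integrable_fin_num.
rewrite Gfin; congr EFin.
pose Phi s := G s - ip (b (p s x)) (p s x).
have : Phi K = Phi (- K); last first.
  have G0 : G (- K) = 0 by rewrite /G set_itv_ge ?bnd_simp ?ltxx // Rintegral_set0.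
  by rewrite /Phi ptop pbot ip0r G0; lra.
apply: (@small_increments _ (fun s => ip (p s x) x)) => // s t Ks st tK.
have sub : `]s, t]%classic `<=` D.
  move=> l; rewrite /D /= !in_itv /= => /andP[h1 h2].
  by apply/andP; split; [apply: le_lt_trans h1|apply: le_trans tK].
have sub' : `]- K, s]%classic `<=` D.
  move=> l; rewrite /D /= !in_itv /= => /andP[h1 h2].
  by rewrite h1 (le_trans h2) // (le_trans st).
have GE : G t - G s = \int[mu]_(l in `]s, t]) l.
  rewrite /G (@itv_bndbnd_setU _ _ _ (BRight s)) ?bnd_simp //.
  rewrite Rintegral_setU //; first by ring.
    rewrite -itv_bndbnd_setU ?bnd_simp //; apply: iS => //.
    move=> l; rewrite /D /= !in_itv /= => /andP[h1 h2].
    by rewrite h1 (le_trans h2).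
  apply/disj_setPS => l [] /=; rewrite !in_itv /= => /andP[_ h1] /andP[h2 _].
  by have := le_lt_trans h1 h2; rewrite ltxx.
have icst r : mu.-integrable `]s, t]%classic (EFin \o (fun _ : R => r)).
  apply: measurable_bounded_integrable => //; first by rewrite muI // ltry.
  by exists `|r|; split; [rewrite num_real|move=> M /ltW h l _].
have mst : fine (mu `]s, t]%classic) = ip (p t x) x - ip (p s x) x by rewrite muI.
have lo : s * (ip (p t x) x - ip (p s x) x) <= \int[mu]_(l in `]s, t]) l.
  rewrite -mst -Rintegral_cst //; apply: le_Rintegral => //; first exact: iS.
  by move=> l /=; rewrite in_itv /= => /andP[/ltW].
have hi : \int[mu]_(l in `]s, t]) l <= t * (ip (p t x) x - ip (p s x) x).
  rewrite -mst -Rintegral_cst //; apply: le_Rintegral => //; first exact: iS.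
  by move=> l /=; rewrite in_itv /= => /andP[].
have /andP[lo' hi'] := cut_slice x st.
rewrite /Phi.
have -> : G t - ip (b (p t x)) (p t x) - (G s - ip (b (p s x)) (p s x)) =
  \int[mu]_(l in `]s, t]) l -
    (ip (b (p t x)) (p t x) - ip (b (p s x)) (p s x)) by rewrite -GE; ring.
by rewrite ler_norml; apply/andP; split; lra.
Qed.

End Family.

Lemma spectral_measure_exists : exists E, is_spectral_measure dot b E.
Proof.
have [p cp] := choice (cut_exists hdot bb sb).
have pp s : is_projection (p s) by exact: cut_proj (cp s).
have [L L0 bL] := op_form_bound hdot bb.
have ex x : exists mu : {measure set R -> \bar R},
    (forall s t, s <= t -> mu `]s, t]%classic = (ip (p t x) x - ip (p s x) x)%:E)
    /\ mu setT = (ip x x)%:E.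
  apply: (@stieltjes_finite _ (fun s => ip (p s x) x) L) => //.
  - exact: cut_form_mono.
  - exact: cut_form_rc.
  - by move=> s sL; rewrite (cut_bot (cp s) bL sL) ip0l.
  - by move=> s sL; rewrite (cut_top (cp s) bL sL).
have [mu muP] := choice ex.
have muT x : mu x setT = (ip x x)%:E by have [] := muP x.
have mu_itv s t : exists P, represents dot mu `]s, t]%classic P.
  have [st|ts] := leP s t; last first.
    exists 0; rewrite set_itv_ge ?bnd_simp -?leNgt ?(ltW ts) //.
    exact: represents0.
  exists (p t - p s); split=> [|x]; first exact: cut_diff_proj.
  by rewrite (muP x).1 // -[(p t - p s) x]/(p t x - p s x) ipBl.
have [E [rE ET EI]] := represents_family hdot muT mu_itv.
exists E; split=> //.
- by move=> A /rE[].
- exists (L + 1).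
  have mK : measurable `[- (L + 1), L + 1]%classic by exact: measurable_itv.
  apply: (represents_uniq hdot (rE _ mK)); split; first exact: proj1.
  move=> x; apply/eqP; rewrite eq_le; apply/andP; split.
    by rewrite -muT; apply: le_measure; rewrite ?inE.
  have <- : mu x `]- (L + 1), L + 1]%classic = (ip x x)%:E.
    rewrite (muP x).1; last by lra.
    rewrite (cut_top (cp (L + 1)) bL); last by lra.
    by rewrite (cut_bot (cp (- (L + 1))) bL) ?ip0l ?subr0 //; lra.
  apply: le_measure; rewrite ?inE //.
  by move=> l /=; rewrite !in_itv /= => /andP[/ltW-> ->].
- move=> x; exists (mu x).
  have [h1 h2] := spectral_integral cp L0 bL (muT x) (muP x).1.
  by split=> // A mA; have [_ hE] := rE _ mA; exact: hE.
Qed.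

End SpectralTheorem.

(** * Consequences for an arbitrary spectral measure *)

Section AffineMoment.
Variables (R : realType) (mu : {measure set R -> \bar R}) (A : set R) (m v : R).
Hypotheses (mA : measurable A) (muA : mu (~` A) = 0%E) (muT : mu setT = m%:E).
Hypothesis id_int : mu.-integrable setT (fun l : R => l%:E).
Hypothesis id_mean : (\int[mu]_l l%:E)%E = v%:E.
Variables (c d : R).

Let f (l : R) : R := c * l + d.

Let f_int : mu.-integrable setT (EFin \o f).
Proof.
have -> : EFin \o f = ((fun l : R => c%:E * l%:E) \+ (EFin \o (fun=> d)))%E.
  by apply/funext => l; rewrite /f /= EFinD EFinM.
apply: integrableD => //; first exact: integrableZl.
apply: measurable_bounded_integrable => //; first by rewrite muT ltry.
by exists `|d|; split; [rewrite num_real|move=> M /ltW h l _].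
Qed.

Let f_mean : (\int[mu]_(l in A) (f l)%:E)%E = (c * v + d * m)%:E.
Proof.
have mC : measurable (~` A) by exact: measurableC.
have <- : (\int[mu]_l (f l)%:E)%E = (c * v + d * m)%:E.
  have cst_int : mu.-integrable setT (EFin \o (fun _ : R => d)).
    apply: measurable_bounded_integrable => //; first by rewrite muT ltry.
    by exists `|d|; split; [rewrite num_real|move=> M /ltW h l _].
  transitivity (\int[mu]_l (c%:E * l%:E + d%:E))%E.
    by apply: eq_integral => l _; rewrite -EFinM -EFinD.
  rewrite integralD //; last exact: integrableZl.
  by rewrite integralZl // id_mean integral_cst // muT -!EFinM -EFinD.
by rewrite (negligible_integral mC measurableT f_int muA) setTD setCK.
Qed.

(** Applied with slopes 1 and -1, this bounds the mean by the ends of the support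
    from both sides. *)
Lemma affine_moment_ge0 : (forall l, A l -> 0 <= c * l + d) -> 0 <= c * v + d * m.
Proof.
by move=> f0; rewrite -lee_fin -f_mean; apply: integral_ge0 => l Al; rewrite lee_fin f0.
Qed.

Lemma affine_moment_gt0 : (forall l, A l -> 0 < c * l + d) -> 0 < m ->
  0 < c * v + d * m.
Proof.
move=> f0 m0; rewrite lt_neqAle affine_moment_ge0 ?andbT; last first.
  by move=> l /f0/ltW.
apply/eqP => e; have := f_mean; rewrite -e => z.
have mf := measurable_funS measurableT (@subsetT _ A) (measurable_int mu f_int).
have /(ae_eq_integral_abs mu mA mf) ae : (\int[mu]_(x in A) `|(EFin \o f) x| = 0)%E.
  rewrite -[RHS]z; apply: eq_integral => l; rewrite inE => Al /=.
  by rewrite ger0_norm // ltW // f0.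
have mu0 : mu A = 0%E.
  apply: measure_negligible => //; apply: negligibleS ae => l Al /= h.
  by have := f0 l Al; have /= [] := h Al; rewrite /f => ->; rewrite ltxx.
have mC := measurableC mA.
have : (mu A + mu (~` A))%E = m%:E by rewrite -muT -(setUv A) measureU ?setICr.
by rewrite mu0 muA adde0 => -[] m00; rewrite -m00 ltxx in m0.
Qed.

End AffineMoment.

Section SpectralMeasureFacts.
Variables (R : realType) (H : completeNormedModType R[i]).
Variable dot : {dot H for Num.conj}.
Hypothesis hdot : hilbert_dot dot.
Local Notation ip := (real_dot dot).
Local Notation is_projection := (is_projection dot).
Variables (b : H -> H) (E : set R -> H -> H).
Hypotheses (bb : @bounded_op R H b) (sb : self_adjoint dot b).
Hypothesis smE : is_spectral_measure dot b E.

Let lb : linear b.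
Proof. by case: bb. Qed.

Lemma sm_measures : exists mu : H -> {measure set R -> \bar R},
  [/\ forall x, mu x setT = (ip x x)%:E,
      forall A, measurable A -> represents dot mu A (E A),
      forall x, (mu x).-integrable setT (fun l : R => l%:E)
    & forall x, (\int[mu x]_l l%:E)%E = (ip (b x) x)%:E].
Proof.
have [mu muP] := choice (sm_integral smE); exists mu; split.
- by move=> x; have [-> // _ _] := muP x; rewrite (sm_full smE).
- move=> A mA; split; first exact: (sm_projection smE).
  by move=> x; have [-> // _ _] := muP x.
- by move=> x; have [] := muP x.
- by move=> x; have [] := muP x.
Qed.

Lemma sm_compl A : measurable A -> E (~` A) = idfun - E A.
Proof.
move=> mA; have [mu [muT rE _ _]] := sm_measures.
have mC : measurable (~` A) by exact: measurableC.
exact: (represents_uniq hdot (rE _ mC) (representsC hdot muT mA (rE _ mA))).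
Qed.

Lemma sm_comm A B x : measurable A -> measurable B -> E A (E B x) = E B (E A x).
Proof.
move=> mA mB; have := sm_setI smE mA mB; rewrite setIC (sm_setI smE mB mA).
by move=> /(congr1 (fun f => f x)).
Qed.

(** The measure of y + z is the sum of those of y and z when the two vectors lie
    in complementary spectral subspaces, so b has no cross term between them. *)
Lemma sm_reduces A x : measurable A -> E A (b x) = b (E A x).
Proof.
move=> mA; have [mu [muT rE muI mub]] := sm_measures.
have pE B (mB : measurable B) : is_projection (E B) := sm_projection smE mB.
have pA := pE A mA.
have cross y z : E A y = y -> E A z = 0 -> ip (b y) z = 0.
  move=> Ay Az.
  have madd : forall B, measurable B -> B `<=` setT ->
      mu (y + z) B = measure_add (mu y) (mu z) B.
    move=> B mB _; rewrite measure_addE.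
    have [_ h] := rE _ mB; rewrite !h -EFinD; congr EFin.
    have yz : ip (E B y) z = 0.
      by rewrite -Ay sm_comm // (proj_ip pA) Az ip0r.
    rewrite (linD (proj_lin (pE B mB))) !(ipDl, ipDr) yz.
    by rewrite (proj_ip (pE B mB) z y) (ipC _ z) yz; ring.
  have : (ip (b (y + z)) (y + z))%:E = (ip (b y) y + ip (b z) z)%:E.
    rewrite -mub (eq_measure_integral _ madd) integral_measure_add //.
    by rewrite !mub EFinD.
  move=> []; rewrite (linD lb) !(ipDl, ipDr) (sa_ip z y sb) (ipC _ z); lra.
have /(congr1 (fun f => f x)) : E A \o b = b \o E A; last by [].
apply: (proj_comm hdot pA lb sb) => y Ay.
apply/eqP; rewrite eq_sym -subr_eq0; set w := b y - E A (b y).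
have Aw : E A w = 0 by exact: (proj_compl_ker pA).
apply/eqP/(ipxx_eq0 hdot); rewrite {1}/w ipBl cross // (proj_ip pA) Aw ip0r.
by rewrite subr0.
Qed.

Lemma sm_affine_ge0 A x c d : measurable A -> E A x = x ->
  (forall l, A l -> 0 <= c * l + d) -> 0 <= c * ip (b x) x + d * ip x x.
Proof.
move=> mA Ax; have [mu [muT rE muI mub]] := sm_measures.
apply: (@affine_moment_ge0 _ (mu x) A) => //.
have mC : measurable (~` A) by exact: measurableC.
have [_ ->] := rE _ mC.
by rewrite sm_compl // -[(_ - _) x]/(x - E A x) Ax subrr ip0l.
Qed.

Lemma sm_affine_gt0 A x c d : measurable A -> E A x = x -> x != 0 ->
  (forall l, A l -> 0 < c * l + d) -> 0 < c * ip (b x) x + d * ip x x.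
Proof.
move=> mA Ax x0 f0; have [mu [muT rE muI mub]] := sm_measures.
apply: (@affine_moment_gt0 _ (mu x) A) => //; last first.
  by rewrite (ipxx hdot) exprn_gt0 // nrm_gt0.
have mC : measurable (~` A) by exact: measurableC.
have [_ ->] := rE _ mC.
by rewrite sm_compl // -[(_ - _) x]/(x - E A x) Ax subrr ip0l.
Qed.

(** On spectral subspaces the form of b is a mean over the corresponding set. *)
Lemma sm_cut_le s : spectral_cut dot b s (E `]-oo, s]%classic).
Proof.
have mA : measurable (`]-oo, s]%classic : set R) by exact: measurable_itv.
have pA := sm_projection smE mA; split=> // [x|x Ax|x Ax x0].
- exact: sm_reduces.
- suff : 0 <= -1 * ip (b x) x + s * ip x x by lra.
  by apply: (sm_affine_ge0 mA Ax) => l; rewrite /= in_itv /=; lra.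
- have mC : measurable (~` `]-oo, s]%classic : set R) by exact: measurableC.
  suff : 0 < 1 * ip (b x) x + (- s) * ip x x by lra.
  apply: (sm_affine_gt0 mC) => //.
    by rewrite sm_compl // -[LHS]/(x - E `]-oo, s]%classic x) Ax subr0.
  by move=> l /=; rewrite in_itv /= => /negP; rewrite -ltNge; lra.
Qed.

(** Strictness now falls on the open half-line, so it is the complement of the
    projection that is a cut, for the opposite operator. *)
Lemma sm_cut_lt s : spectral_cut dot (- b) (- s) (idfun - E `]-oo, s[%classic).
Proof.
have mA : measurable (`]-oo, s[%classic : set R) by exact: measurable_itv.
have pA := sm_projection smE mA.
have cE x : (idfun - E `]-oo, s[%classic) x = x - E `]-oo, s[%classic x by [].
have bE x : (- b) x = - b x by [].
split=> [|x|x|x].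
- exact: proj_compl.
- by rewrite !cE !bE (linB lb) (linN (proj_lin pA)) sm_reduces // opprB opprK addrC.
- rewrite -(sm_compl mA) bE ipNl => Ax.
  have mC : measurable (~` `]-oo, s[%classic : set R) by exact: measurableC.
  suff : 0 <= 1 * ip (b x) x + (- s) * ip x x by lra.
  apply: (sm_affine_ge0 mC) => // l /=; rewrite in_itv /= => /negP.
  by rewrite -leNgt; lra.
- rewrite cE bE ipNl => /eqP; rewrite subr_eq0 => /eqP Ax x0.
  suff : 0 < -1 * ip (b x) x + s * ip x x by lra.
  apply: (sm_affine_gt0 mA) => //.
  by move=> l; rewrite /= in_itv /=; lra.
Qed.

End SpectralMeasureFacts.

(** * The trace and the intervals of spectral projections *)

Section Trace.
Variables (R : realType) (H : completeNormedModType R[i]).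
Variable dot : {dot H for Num.conj}.
Hypothesis hdot : hilbert_dot dot.
Local Notation ip := (real_dot dot).
Local Notation is_projection := (is_projection dot).
Variable M : set (H -> H).
Hypothesis hM : von_neumann_algebra dot M.

Lemma vna0 : M 0.
Proof.
have M1 := vna_one hM.
have := vna_linear hM (-1) M1 M1; suff -> : -1 *: (idfun : H -> H) + idfun = 0 by [].
by apply/funext => x; rewrite -[LHS]/(-1 *: x + x) scaleN1r addNr.
Qed.

Lemma vnaZ k a : M a -> M (k *: a).
Proof.
by move=> Ma; rewrite -[k *: a]addr0; apply: (vna_linear hM) => //; exact: vna0.
Qed.

Lemma vnaD a c : M a -> M c -> M (a + c).
Proof. by move=> Ma Mc; rewrite -[a]scale1r; exact: (vna_linear hM). Qed.

Lemma vnaN a : M a -> M (- a).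
Proof. by move=> Ma; rewrite -scaleN1r; exact: vnaZ. Qed.

Lemma vnaB a c : M a -> M c -> M (a - c).
Proof. by move=> Ma Mc; apply: vnaD => //; exact: vnaN. Qed.

Lemma vna_lin a : M a -> linear a.
Proof. by move=> /(vna_bounded hM)[]. Qed.

(** Membership in M is tested on bounded operators commuting with M. *)
Lemma vna_bicomm a : @bounded_op R H a ->
  (forall d K, linear d -> 0 <= K -> bounded_by d K ->
    (forall c, M c -> d \o c = c \o d) ->
    a \o d = d \o a) -> M a.
Proof.
move=> ba comm; rewrite -(vna_bicommutant hM); split=> // d [bd dM].
by have /bounded_opP[ld [K K0 dK]] := bd; exact: comm dK dM.
Qed.

Lemma cut_in_vna b s p : M b -> self_adjoint dot b -> spectral_cut dot b s p -> M p.
Proof.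
move=> Mb sb cp; apply: vna_bicomm; first by case: (cut_proj cp).
move=> d K ld K0 dK dM.
apply: (cut_commute hdot (vna_bounded hM Mb) sb cp ld K0 dK) => x.
exact: (congr1 (fun f => f x) (dM b Mb)).
Qed.

Lemma sqrt_in_vna T : M T -> self_adjoint dot T ->
  (forall x, 0 <= ip (T x) x <= ip x x) ->
  exists r, [/\ M r, self_adjoint dot r & r \o r = T].
Proof.
move=> MT sT T01; have [r [[lr br] sr _ rT comm]] := psd_sqrt hdot (vna_lin MT) sT T01.
exists r; split=> //; apply: vna_bicomm.
  exact: (bounded_by_bounded_op lr (ler0n R 2) br).
by move=> d K ld K0 dK dM; rewrite (comm d K) //; exact: dM.
Qed.

Lemma unit_interval_facts a : unit_interval dot M a ->
  [/\ M a, linear a, self_adjoint dot a & forall x, 0 <= ip (a x) x <= ip x x].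
Proof.
move=> [Ma a0 a1]; have la := vna_lin Ma; split=> //; first exact: psd_sa.
move=> x; have := op_le_ip x a0; have := op_le_ip x a1.
by rewrite -[(0 : H -> H) x]/(0 : H) ip0l => -> ->.
Qed.

Lemma unit_interval_intro a : M a -> self_adjoint dot a ->
  (forall x, 0 <= ip (a x) x <= ip x x) -> unit_interval dot M a.
Proof.
move=> Ma sa h; split=> //.
  by apply/(op_leP (@sa0 _ _ dot) sa) => x; have /andP[+ _] := h x; rewrite ip0l.
by apply/(op_leP sa (@sa_id _ _ dot)) => x; have /andP[] := h x.
Qed.

Lemma proj_unit_interval p : is_projection p -> M p -> unit_interval dot M p.
Proof.
move=> pp Mp; apply: unit_interval_intro => //; first exact: proj_sa pp.
move=> x; rewrite (proj_form hdot pp) sqr_ge0 (ipxx hdot) ler_pXn2r ?nnegrE ?nrm_ge0 //.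
by have := proj_bounded_by hdot pp x; rewrite mul1r.
Qed.

Lemma unit_interval_compl a : unit_interval dot M a -> unit_interval dot M (idfun - a).
Proof.
move=> /unit_interval_facts[Ma la sa a01]; apply: unit_interval_intro.
- by apply: vnaB => //; exact: vna_one hM.
- exact: saB (@sa_id _ _ dot) sa.
- move=> x; rewrite -[(idfun - a) x]/(x - a x) ipBl.
  by have /andP[h1 h2] := a01 x; apply/andP; split; lra.
Qed.

Variable tau : (H -> H) -> R[i].
Hypothesis htau : faithful_normal_tracial_state dot M tau.

Definition tr (a : H -> H) : R := complex.Re (tau a).

Lemma trD a c : M a -> M c -> tr (a + c) = tr a + tr c.
Proof.
move=> Ma Mc; have := tau_linear htau 1 Ma Mc.
by rewrite scale1r mul1r /tr => ->; rewrite Re_add.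
Qed.

Lemma tr0 : tr 0 = 0.
Proof. by have := trD vna0 vna0; rewrite addr0; lra. Qed.

Lemma trZ (r : R) a : M a -> tr (r%:C%C *: a) = r * tr a.
Proof.
move=> Ma; have := tau_linear htau r%:C%C Ma vna0; rewrite addr0 => h.
have t0 : tau 0 = 0.
  have := tau_linear htau 1 vna0 vna0; rewrite scale1r mul1r addr0 => /eqP.
  by rewrite -subr_eq0 opprD addrA subrr sub0r oppr_eq0 => /eqP.
by rewrite /tr h t0 addr0 Re_rscale.
Qed.

Lemma trN a : M a -> tr (- a) = - tr a.
Proof.
move=> Ma; have := trZ (-1) Ma; rewrite rmorphN rmorph1 scaleN1r mulN1r; exact.
Qed.

Lemma trB a c : M a -> M c -> tr (a - c) = tr a - tr c.
Proof. by move=> Ma Mc; rewrite trD ?trN //; exact: vnaN. Qed.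

Lemma tr1 : tr idfun = 1.
Proof. by rewrite /tr (tau_one htau). Qed.

Lemma tr_sum n (t : 'I_n -> R) (B : 'I_n -> H -> H) : (forall i, M (B i)) ->
  M (\sum_(i < n) (t i)%:C%C *: B i) /\
  tr (\sum_(i < n) (t i)%:C%C *: B i) = \sum_(i < n) t i * tr (B i).
Proof.
move=> MB; elim/big_ind2: _ => [|x x' y y' [Mx <-] [My <-]|i _].
- by split; [exact: vna0|exact: tr0].
- by split; [exact: vnaD|exact: trD].
- by split; [exact: vnaZ|exact: trZ].
Qed.

(** On positive elements the trace is real, so faithfulness can be used on its
    real part. *)
Lemma tr_psd a : M a -> self_adjoint dot a -> (forall x, 0 <= ip (a x) x) ->
  0 <= tr a /\ (tr a <= 0 -> a = 0).
Proof.
move=> Ma sa pa; have a0 : op_le dot 0 a.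
  by apply/(op_leP (@sa0 _ _ dot) sa) => x; rewrite ip0l.
have := tau_positive htau Ma a0; rewrite lecE => /andP[/eqP im re].
split=> // tr0; apply: (tau_faithful htau Ma a0).
apply/eqP; rewrite eq_complex /= im eqxx andbT eq_le re andbT.
exact: tr0.
Qed.

(** Traciality turns tau (c a) into tau (r c r), with r the square root of a;
    faithfulness then makes the product vanish when its trace does. *)
Lemma tr_mul_psd c a : M c -> self_adjoint dot c -> (forall x, 0 <= ip (c x) x) ->
  unit_interval dot M a ->
  0 <= tr (c \o a) /\ (tr (c \o a) <= 0 -> forall x, c (a x) = 0).
Proof.
move=> Mc sc pc ua; have [Ma la sa a01] := unit_interval_facts ua.
have [r [Mr sr ra]] := sqrt_in_vna Ma sa a01.
have Mcr : M (c \o r) by exact: (vna_comp hM).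
have e : tr (c \o a) = tr (r \o (c \o r)).
  by rewrite /tr -(tau_trace htau Mcr Mr) -ra.
have srcr : self_adjoint dot (r \o (c \o r)).
  by move=> x y /=; rewrite sr sc sr.
have q x : ip ((r \o (c \o r)) x) x = ip (c (r x)) (r x) by rewrite /= (sa_ip _ _ sr).
have [t0 t1] : 0 <= tr (r \o (c \o r)) /\
    (tr (r \o (c \o r)) <= 0 -> r \o (c \o r) = 0).
  by apply: tr_psd => // [|x]; [exact: (vna_comp hM)|rewrite q].
rewrite e; split=> // /t1 z x; rewrite -ra /=.
apply: (psd_ker hdot (vna_lin Mc) sc pc); rewrite -q z.
by rewrite -[(0 : H -> H) _]/(0 : H) ip0l.
Qed.

End Trace.

Section SpectralInterval.
Variables (R : realType) (H : completeNormedModType R[i]).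
Variable dot : {dot H for Num.conj}.
Hypothesis hdot : hilbert_dot dot.
Local Notation ip := (real_dot dot).
Local Notation is_projection := (is_projection dot).
Variable M : set (H -> H).
Hypothesis hM : von_neumann_algebra dot M.
Variable tau : (H -> H) -> R[i].
Hypothesis htau : faithful_normal_tracial_state dot M tau.
Local Notation tr := (tr tau).
Variables (b : H -> H) (s : R).
Hypotheses (Mb : M b) (sb : self_adjoint dot b).

Local Notation p := (spectral_projection dot b `]-oo, s]%classic).
Local Notation m := (spectral_projection dot b `]-oo, s[%classic).

Let bb : @bounded_op R H b := vna_bounded hM Mb.
Let lb : linear b := vna_lin hM Mb.

Lemma spectral_projectionP : is_spectral_measure dot b (spectral_projection dot b).
Proof. by apply: getPex; exact: (spectral_measure_exists hdot bb sb). Qed.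

Lemma upper_cut : spectral_cut dot b s p.
Proof. exact: (sm_cut_le hdot bb sb spectral_projectionP). Qed.

Lemma lower_cut : spectral_cut dot (- b) (- s) (idfun - m).
Proof. exact: (sm_cut_lt hdot bb sb spectral_projectionP). Qed.

Lemma upper_proj : is_projection p.
Proof. exact: cut_proj upper_cut. Qed.

Lemma lower_proj : is_projection m.
Proof. by apply: (sm_projection spectral_projectionP); exact: measurable_itv. Qed.

Lemma upper_in_vna : M p.
Proof. exact: (cut_in_vna hdot hM Mb sb upper_cut). Qed.

Lemma lower_in_vna : M m.
Proof.
have := cut_in_vna hdot hM (vnaN hM Mb) (saN sb) lower_cut.
by move=> /(vnaB hM (vna_one hM)); rewrite opprB addrC subrK.
Qed.

Lemma upper_lower x : p (m x) = m x.
Proof.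
have mp : measurable (`]-oo, s]%classic : set R) by exact: measurable_itv.
have mm : measurable (`]-oo, s[%classic : set R) by exact: measurable_itv.
have := sm_setI spectral_projectionP mp mm; rewrite setIidr.
  by move=> /(congr1 (fun f => f x)).
by move=> l /=; rewrite !in_itv /= => /ltW.
Qed.

Lemma lower_upper x : m (p x) = m x.
Proof. by apply: (proj_absorb hdot lower_proj upper_proj); exact: upper_lower. Qed.

Definition shifted : H -> H := b - s%:C%C *: idfun.
Local Notation c := shifted.

Lemma shiftedE x : c x = b x - rscale s x.
Proof. by []. Qed.

Lemma shifted_in_vna : M c.
Proof. by apply: (vnaB hM) => //; apply: (vnaZ hM); exact: (vna_one hM). Qed.

Lemma shifted_sa : self_adjoint dot c.
Proof. by apply: saB => //; apply: saZ. Qed.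

Let lc : linear c := vna_lin hM shifted_in_vna.

Lemma shifted_ip x : ip (c x) x = ip (b x) x - s * ip x x.
Proof. by rewrite shiftedE ipBl ipZl. Qed.

Lemma shifted_upper x : c (p x) = p (c x).
Proof.
rewrite !shiftedE (linB (proj_lin upper_proj)) (linR (proj_lin upper_proj)).
by rewrite (cut_comm upper_cut).
Qed.

Lemma shifted_lower x : c (m x) = m (c x).
Proof.
rewrite !shiftedE (linB (proj_lin lower_proj)) (linR (proj_lin lower_proj)).
by rewrite (sm_reduces hdot bb sb spectral_projectionP) //; exact: measurable_itv.
Qed.

Lemma upper_le0 x : p x = x -> ip (c x) x <= 0.
Proof. by move=> /(cut_le upper_cut); rewrite shifted_ip; lra. Qed.

Lemma upper_compl_gt0 x : p x = 0 -> x != 0 -> 0 < ip (c x) x.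
Proof. by move=> px /(cut_gt upper_cut px); rewrite shifted_ip; lra. Qed.

Lemma lower_compl_ge0 x : m x = 0 -> 0 <= ip (c x) x.
Proof.
move=> mx; have qx : (idfun - m) x = x by rewrite -[LHS]/(x - m x) mx subr0.
by have := cut_le lower_cut qx; rewrite -[(- b) x]/(- b x) ipNl shifted_ip; lra.
Qed.

Lemma lower_lt0 x : m x = x -> x != 0 -> ip (c x) x < 0.
Proof.
move=> mx x0; have qx : (idfun - m) x = 0 by rewrite -[LHS]/(x - m x) mx subrr.
by have := cut_gt lower_cut qx x0; rewrite -[(- b) x]/(- b x) ipNl shifted_ip; lra.
Qed.

Lemma upper_ker x : p x = 0 -> c x = 0 -> x = 0.
Proof.
move=> px cx; have [//|x0] := eqVneq x 0.
by have := upper_compl_gt0 px x0; rewrite cx ip0l ltxx.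
Qed.

Lemma lower_ker x : m x = x -> c x = 0 -> x = 0.
Proof.
move=> mx cx; have [//|x0] := eqVneq x 0.
by have := lower_lt0 mx x0; rewrite cx ip0l ltxx.
Qed.

(** Between the two half-lines only the eigenspace of s is left. *)
Lemma shifted_diff x : c (p x - m x) = 0.
Proof.
pose D := p - m; have DE y : D y = p y - m y by [].
have lD : linear D.
  by apply: lin_sub; [exact: proj_lin upper_proj|exact: proj_lin lower_proj].
have sD : self_adjoint dot D.
  by apply: saB; [exact: proj_sa upper_proj|exact: proj_sa lower_proj].
have DD y : D (D y) = D y.
  rewrite !DE (linB (proj_lin upper_proj)) (linB (proj_lin lower_proj)).
  rewrite (proj_idem upper_proj) (proj_idem lower_proj) upper_lower lower_upper.
  by rewrite subrr subr0.
have cD y : c (D y) = D (c y).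
  by rewrite !DE (linB lc) shifted_upper shifted_lower.
suff : c \o D = 0 by move=> /(congr1 (fun f => f x)).
apply: (sa_diag0 hdot) => [||y].
- exact: lin_comp lc lD.
- by apply: sa_comp => //; [exact: shifted_sa|apply/funext => y; exact: cD].
- rewrite /= -DD cD (sa_ip _ _ sD).
  have up : p (D y) = D y.
    by rewrite DE (linB (proj_lin upper_proj)) (proj_idem upper_proj) upper_lower.
  have lo : m (D y) = 0.
    by rewrite DE (linB (proj_lin lower_proj)) (proj_idem lower_proj) lower_upper subrr.
  by apply/eqP; rewrite eq_le upper_le0 // lower_compl_ge0.
Qed.

Section OneElement.
Variable a : H -> H.
Hypothesis ua : unit_interval dot M a.

(* positive and negative parts of c *)
Let cpos : H -> H := c - (c \o p).
Let cneg : H -> H := - (c \o m).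

Let cposE x : cpos x = c (x - p x).
Proof. by rewrite -[LHS]/(c x - c (p x)) (linB lc). Qed.

Let cnegE x : cneg x = - c (m x).
Proof. by []. Qed.

(* the decomposition of tau (c a) - tau (c m) into two nonnegative terms *)
Let compare :
  [/\ 0 <= tr (cpos \o a) /\ (tr (cpos \o a) <= 0 -> forall x, cpos (a x) = 0),
      0 <= tr (cneg \o (idfun - a)) /\
        (tr (cneg \o (idfun - a)) <= 0 -> forall x, cneg ((idfun - a) x) = 0)
    & tr (c \o a) = tr (c \o m) + tr (cpos \o a) + tr (cneg \o (idfun - a))].
Proof.
have [Ma la sa a01] := unit_interval_facts hM ua.
have Mc := shifted_in_vna; have sc := shifted_sa.
have Mp := upper_in_vna; have Mm := lower_in_vna.
have Mcp : M (c \o p) by exact: (vna_comp hM).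
have Mcm : M (c \o m) by exact: (vna_comp hM).
have Mpos : M cpos by exact: (vnaB hM).
have Mneg : M cneg by exact: (vnaN hM).
have pp := upper_proj; have pm := lower_proj.
have spos : self_adjoint dot cpos.
  apply: saB => //; apply: sa_comp => //; first exact: proj_sa pp.
  by apply/funext => x; exact: shifted_upper.
have sneg : self_adjoint dot cneg.
  apply: saN; apply: sa_comp => //; first exact: proj_sa pm.
  by apply/funext => x; exact: shifted_lower.
have ppos x : 0 <= ip (cpos x) x.
  rewrite cposE; set y := x - p x; have py : p y = 0 by exact: (proj_compl_ker pp).
  have -> : ip (c y) x = ip (c y) y.
    by rewrite /y ipBr -(proj_ip pp) -shifted_upper py (lin0 lc) ip0l subr0.
  have [->|y0] := eqVneq y 0; first by rewrite ip0r.
  exact/ltW/upper_compl_gt0.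
have pneg x : 0 <= ip (cneg x) x.
  rewrite cnegE ipNl oppr_ge0 -(proj_idem pm) shifted_lower (proj_ip pm).
  have [->|y0] := eqVneq (m x) 0; first by rewrite ip0r.
  by apply/ltW/lower_lt0 => //; exact: (proj_idem pm).
have uc := unit_interval_compl hM ua.
split.
- exact: (tr_mul_psd hdot hM htau Mpos spos ppos ua).
- exact: (tr_mul_psd hdot hM htau Mneg sneg pneg uc).
have M1 : M (cpos \o a) by exact: (vna_comp hM).
have M2 : M (cneg \o (idfun - a)).
  by apply: (vna_comp hM) => //; case: uc.
rewrite -(trD htau Mcm M1) -(trD htau _ M2); last exact: (vnaD hM).
congr (tr _); apply/funext => x.
rewrite -[RHS]/(c (m x) + cpos (a x) + cneg (x - a x)) cposE cnegE.
rewrite (linB (proj_lin pm)) (linB lc (m x)) opprB.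
rewrite addrC addrA subrK -(linD lc).
have := shifted_diff (a x); rewrite (linB lc) => /eqP; rewrite subr_eq0 => /eqP h.
by rewrite (linD lc) (linB lc) h addrC subrK.
Qed.

Lemma interval_min : tr (c \o m) <= tr (c \o a).
Proof. by have [[h1 _] [h2 _] ->] := compare; lra. Qed.

(** The two nonnegative terms vanish iff c+ a = 0 and c- (1 - a) = 0; since c+ is
    injective on the complement of p, and c- on the range of m, this says that
    p a = a and m (1 - a) = 0. *)
Lemma interval_min_eq : tr (c \o a) = tr (c \o m) <-> op_interval dot M m p a.
Proof.
have [Ma la sa a01] := unit_interval_facts hM ua.
have pp := upper_proj; have pm := lower_proj.
have [[h1 h1'] [h2 h2'] e] := compare; split=> [eq|[_ ma ap]].
  have pa x : p (a x) = a x.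
    have := h1' _ x; rewrite cposE => /(_ ltac:(lra)) z.
    apply/eqP; rewrite eq_sym -subr_eq0; apply/eqP.
    by apply: upper_ker => //; exact: (proj_compl_ker pp).
  have am x : a (m x) = m x.
    have := h2' ltac:(lra) => z.
    have mz y : m (y - a y) = 0.
      apply: lower_ker; first exact: (proj_idem pm).
      by have := z y; rewrite cnegE => /eqP; rewrite oppr_eq0 => /eqP.
    apply: (ip_ext hdot) => v; rewrite (sa_ip _ _ sa) !(proj_ip pm).
    have := mz v; rewrite (linB (proj_lin pm)) => /eqP.
    by rewrite subr_eq0 => /eqP ->.
  split=> //.
    apply/(op_leP (proj_sa pm) sa) => x; pose y := x - m x.
    have my : m y = 0 by exact: (proj_compl_ker pm).
    have xy : x = m x + y by rewrite addrC subrK.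
    clearbody y.
    have z1 : ip (m x) y = 0 by rewrite (proj_ip pm) my ip0r.
    have -> : ip (a x) x = ip (m x) (m x) + ip (a y) y.
      rewrite {1 2}xy (linD la) am !(ipDl, ipDr) z1.
      by rewrite (sa_ip _ _ sa) am (ipC _ y) z1; ring.
    have -> : ip (m x) x = ip (m x) (m x).
      by rewrite [RHS](proj_ip pm) (proj_idem pm) (proj_ip pm).
    by rewrite lerDl; have /andP[] := a01 y.
  apply/(op_leP sa (proj_sa pp)) => x.
  have ap y : a (p y) = a y.
    by apply: (ip_ext hdot) => v; rewrite (sa_ip _ _ sa) (proj_ip pp) pa (sa_ip _ _ sa).
  rewrite -(ap x) -(pa (p x)) (proj_ip pp).
  have /andP[_ h] := a01 (p x); apply: le_trans h _.
  by rewrite [leLHS](proj_ip pp) (proj_idem pp) (proj_ip pp).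
have pa x : p (a x) = a x.
  have aq y : a (y - p y) = 0.
    apply: (psd_ker hdot la sa) => [z|]; first by have /andP[] := a01 z.
    have := op_le_ip (y - p y) ap; rewrite (proj_compl_ker pp) ip0l; exact.
  apply: (ip_ext hdot) => v; rewrite (proj_ip pp) !(sa_ip _ _ sa).
  by have := aq v; rewrite (linB la) => /eqP; rewrite subr_eq0 => /eqP ->.
have mx x : m (x - a x) = 0.
  pose d := idfun - a; have dE y : d y = y - a y by [].
  have ld : linear d by exact: (lin_sub (@id_linear _ _) la).
  have sd : self_adjoint dot d by exact: (saB (@sa_id _ _ dot) sa).
  have dm y : d (m y) = 0.
    apply: (psd_ker hdot ld sd) => [z|].
      by rewrite dE ipBl subr_ge0; have /andP[] := a01 z.
    by have := op_le_ip (m y) ma; rewrite (proj_idem pm) dE ipBl subr_le0.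
  rewrite -dE; apply: (ip_ext hdot) => v.
  by rewrite (proj_ip pm) (sa_ip _ _ sd) dm ip0r ip0l.
rewrite e; have -> : cpos \o a = 0.
  by apply/funext => x; rewrite /= cposE pa subrr (lin0 lc).
have -> : cneg \o (idfun - a) = 0.
  by apply/funext => x; rewrite -[LHS]/(- c (m (x - a x))) mx (lin0 lc) oppr0.
by rewrite !(tr0 hM htau) !addr0.
Qed.

End OneElement.

Lemma lower_in_interval : op_interval dot M m p m.
Proof.
have um := proj_unit_interval hdot lower_proj lower_in_vna.
exact/(interval_min_eq um).
Qed.

Lemma upper_in_interval : op_interval dot M m p p.
Proof.
have pp := upper_proj; have pm := lower_proj.
split; first exact: (proj_unit_interval hdot pp upper_in_vna).
  apply/(op_leP (proj_sa pm) (proj_sa pp)) => x.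
  rewrite !(proj_form hdot) // -lower_upper ler_pXn2r ?nnegrE ?nrm_ge0 //.
  by have := proj_bounded_by hdot pm (p x); rewrite mul1r.
exact/(op_leP (proj_sa pp) (proj_sa pp)).
Qed.

Lemma interval_eq a : m = p -> op_interval dot M m p a -> a = p.
Proof.
move=> mp [ua]; rewrite mp => pa ap; have [Ma la sa a01] := unit_interval_facts hM ua.
apply: (sa_ext hdot la (proj_lin upper_proj) sa (proj_sa upper_proj)) => x.
by apply/eqP; rewrite eq_le !op_le_ip.
Qed.

Lemma tr_eq_interval : tr m = tr p -> m = p.
Proof.
move=> e; have pp := upper_proj; have pm := lower_proj.
have Mp := upper_in_vna; have Mm := lower_in_vna.
have [_ lep lmp] := upper_in_interval.
apply/eqP; rewrite eq_sym -subr_eq0; apply/eqP.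
have [] := @tr_psd _ _ dot M tau htau (p - m) (vnaB hM Mp Mm).
- by apply: saB; [exact: proj_sa pp|exact: proj_sa pm].
- move=> x; rewrite -[(p - m) x]/(p x - m x) ipBl subr_ge0; exact: op_le_ip.
- by move=> _; apply; rewrite (trB hM htau Mp Mm) e subrr.
Qed.

(** An eigenvector for s lies in the range of p, where c is not positive, and is
    orthogonal to that of m, where c is negative. *)
Lemma eigenvalue_diff : is_eigenvalue s b <-> m <> p.
Proof.
have pp := upper_proj; have pm := lower_proj.
split=> [[x x0 bx] mp|mp].
  have cx : c x = 0 by rewrite shiftedE bx /rscale subrr.
  have px : x - p x = 0.
    apply: upper_ker; first exact: (proj_compl_ker pp).
    by rewrite (linB lc) shifted_upper cx (lin0 (proj_lin pp)) subrr.
  have mx : m x = 0.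
    apply: lower_ker; first exact: (proj_idem pm).
    by rewrite shifted_lower cx (lin0 (proj_lin pm)).
  by move: px; rewrite -mp mx subr0; exact/eqP.
have [x dx] : exists x, p x - m x != 0.
  apply: contra_notP mp => h; apply/funext => x; apply/eqP.
  rewrite eq_sym -subr_eq0; apply/negP => /negP dx; apply: h.
  by exists x.
exists (p x - m x) => //; have := shifted_diff x; rewrite shiftedE => /eqP.
by rewrite subr_eq0 => /eqP.
Qed.

Lemma eigen_diff : b \o (p - m) = s%:C%C *: (p - m).
Proof.
apply/funext => x; have := shifted_diff x; rewrite shiftedE => /eqP.
by rewrite subr_eq0 => /eqP.
Qed.

End SpectralInterval.

(** * Exposed faces as minimizers *)

Section ExposedByMinimum.
Variables (R : realType) (N : nat).
Implicit Types (C F : set 'rV[R]_N) (x y c : 'rV[R]_N).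

Definition pairing c x : R := \sum_(i < N) c 0 i * x 0 i.

Lemma pairingD c x y : pairing c (x + y) = pairing c x + pairing c y.
Proof. by rewrite /pairing -big_split; apply: eq_bigr => i _; rewrite mxE mulrDr. Qed.

Lemma pairingZ c r x : pairing c (r *: x) = r * pairing c x.
Proof. by rewrite /pairing mulr_sumr; apply: eq_bigr => i _; rewrite mxE mulrCA. Qed.

Lemma pairingNl c x : pairing (- c) x = - pairing c x.
Proof. by rewrite /pairing -sumrN; apply: eq_bigr => i _; rewrite mxE mulNr. Qed.

Lemma pairing_gt0 c : c != 0 -> 0 < pairing c c.
Proof.
have sq i : true -> 0 <= c 0 i * c 0 i by rewrite -expr2 sqr_ge0.
move=> c0; rewrite lt_neqAle sumr_ge0 ?andbT //.
apply: contra c0; rewrite eq_sym psumr_eq0 //.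
move=> /allP h; apply/eqP/rowP => i; rewrite mxE.
by have := h i (mem_index_enum i); rewrite mulf_eq0 orbb => /eqP.
Qed.

(** Moving from an interior point against c would decrease a linear functional,
    so the minimum of the functional on a set is not attained in its interior. *)
Lemma minimizer_not_interior C c al x : c != 0 ->
  (forall y, C y -> al <= pairing c y) -> pairing c x = al -> ~ interior C x.
Proof.
move=> c0 min xal /nbhs_ballP[e /= e0 eC].
pose K := 1 + \sum_(i < N) `|c 0 i|.
have K0 : 0 < K by rewrite ltr_wpDr // sumr_ge0.
pose d := e / K; have d0 : 0 < d by rewrite divr_gt0.
have /min : C (x + (- d) *: c).
  apply: eC; split=> // i j; rewrite (ord1 i).
  rewrite /ball /= !mxE opprD addrA subrr add0r mulNr opprK normrM gtr0_norm //.
  rewrite /d mulrAC ltr_pdivrMr // ltr_pM2l // /K (bigD1 j) //=.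
  by rewrite addrCA ltrDl ltr_wpDr // sumr_ge0.
rewrite pairingD pairingZ xal mulNr lerDl oppr_ge0.
by rewrite leNgt mulr_gt0 // pairing_gt0.
Qed.

Lemma minimum_exposed C c al x0 :
  (forall x y (l : R), C x -> C y -> 0 <= l <= 1 -> C (l *: x + (1 - l) *: y)) ->
  c != 0 -> (forall x, C x -> al <= pairing c x) -> C x0 -> pairing c x0 = al ->
  exposed_face C (C `&` hyperplane c al).
Proof.
move=> cC c0 min Cx0 x0al; split; last first.
- exists (hyperplane c al) => //; exists c, al; split=> //; last by right.
  exists x0; split=> //; split; first exact: subset_closure.
  exact: (minimizer_not_interior c0 min x0al).
- by exists x0.
split; first exact: subIsetl.
- move=> x y l; rewrite !inE => -[Cx xal] [Cy yal].
  rewrite -[conv l x y]/(l%:num *: (x : 'rV[R]_N) + (1 - l%:num) *: (y : 'rV[R]_N)).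
  split; first by apply: cC => //; rewrite ge0 le1.
  rewrite /hyperplane /= -/(pairing c _) pairingD !pairingZ.
  by rewrite /pairing xal yal; ring.
move=> x y l Cx Cy /andP[l0 l1] [_ e].
have {}e : l * pairing c x + (1 - l) * pairing c y = al.
  by rewrite -!pairingZ -pairingD.
have := min x Cx; have := min y Cy => hy hx.
have h1 : 0 <= l * (pairing c x - al) by rewrite mulr_ge0 ?subr_ge0 // ltW.
have h2 : 0 <= (1 - l) * (pairing c y - al) by rewrite mulr_ge0 ?subr_ge0 // ltW.
have z1 : l * (pairing c x - al) = 0 by lra.
have z2 : (1 - l) * (pairing c y - al) = 0 by lra.
split; split=> //.
  by move/eqP: z1; rewrite mulf_eq0 gt_eqF //= subr_eq0 => /eqP.
by move/eqP: z2; rewrite mulf_eq0 gt_eqF ?subr_gt0 //= subr_eq0 => /eqP.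
Qed.

(** Up to changing the sign of its equation, a supporting hyperplane bounds the
    set from below. *)
Lemma exposed_faceP C F : exposed_face C F -> F !=set0 /\
  exists c al, [/\ c != 0, forall x, C x -> al <= pairing c x
    & F = C `&` hyperplane c al].
Proof.
move=> [_ F0 [P [c [al [c0 -> _ side]]] FP]]; split=> //.
case: side => side; last by exists c, al; split=> // x /side.
exists (- c), (- al); split.
- by rewrite oppr_eq0.
- by move=> x /side; rewrite pairingNl lerN2.
- rewrite FP; congr (_ `&` _); apply/seteqP; split=> x /= e.
    have xal : pairing c x = al by [].
    suff : pairing (- c) x = - al by [].
    by rewrite pairingNl xal.
  have : pairing (- c) x = - al by [].
  by rewrite pairingNl => /oppr_inj.
Qed.

End ExposedByMinimum.

Section Scale.
Variables (R : realType) (H : completeNormedModType R[i]).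
Variable dot : {dot H for Num.conj}.
Hypothesis hdot : hilbert_dot dot.
Local Notation ip := (real_dot dot).
Variable M : set (H -> H).
Hypothesis hM : von_neumann_algebra dot M.
Variable tau : (H -> H) -> R[i].
Hypothesis htau : faithful_normal_tracial_state dot M tau.
Local Notation tr := (tr tau).
Variables (n : nat) (b : 'I_n -> H -> H).
Hypotheses (hbM : forall i, M (b i)) (hbsa : forall i, self_adjoint dot (b i)).
Local Notation B := (spectral_scale dot M tau b).
Local Notation Psi := (Psi tau b).

Lemma lincomb_in_vna t : M (lincomb b t).
Proof. by have [] := tr_sum hM htau (fun i => t 0 i) hbM. Qed.

Lemma lincomb_sa t : self_adjoint dot (lincomb b t).
Proof.
rewrite /lincomb; elim/big_ind: _ => [|x y sx sy|i _]; first exact: sa0.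
  exact: saD.
exact: saZ.
Qed.

Lemma Psi_left a : Psi a 0 (lshift n 0) = tr a.
Proof. by rewrite row_mxEl mxE. Qed.

Lemma Psi_right a i : Psi a 0 (rshift 1 i) = tr (b i \o a).
Proof. by rewrite row_mxEr mxE. Qed.

Lemma pairing_Psi_row (r : R) t a : M a ->
  pairing (row_mx (\row_(_ < 1) r) t) (Psi a) = tr (lincomb b t \o a) + r * tr a.
Proof.
move=> Ma; rewrite /pairing big_split_ord /= big_ord1 row_mxEl mxE Psi_left addrC.
congr (_ + _); have Mba i : M (b i \o a) by exact: (vna_comp hM).
have [_ e] := tr_sum hM htau (fun i => t 0 i) Mba.
have -> : lincomb b t \o a = \sum_(i < n) (t 0 i)%:C%C *: (b i \o a).
  apply/funext => x; rewrite /lincomb /= !fct_sumE.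
  by apply: eq_bigr.
by rewrite e; apply: eq_bigr => i _; rewrite row_mxEr Psi_right.
Qed.

Lemma pairing_Psi s t a : M a ->
  pairing (row_mx (\row_(_ < 1) (- s)) t) (Psi a) = tr (shifted (lincomb b t) s \o a).
Proof.
move=> Ma; rewrite pairing_Psi_row //.
have Mba : M (lincomb b t \o a) by apply: (vna_comp hM) => //; exact: lincomb_in_vna.
have -> : shifted (lincomb b t) s \o a = lincomb b t \o a + (- s)%:C%C *: a.
  apply/funext => x; rewrite -[RHS]/(lincomb b t (a x) + (- s)%:C%C *: a x).
  by rewrite rmorphN scaleNr.
by rewrite (trD htau) ?(trZ hM htau) //; exact: (vnaZ hM).
Qed.

Lemma scale_convex x y (l : R) : B x -> B y -> 0 <= l <= 1 ->
  B (l *: x + (1 - l) *: y).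
Proof.
move=> [a ua <-] [c uc <-] /andP[l0 l1].
have [Ma la sa a01] := unit_interval_facts hM ua.
have [Mc lc sc c01] := unit_interval_facts hM uc.
pose d := l%:C%C *: a + (1 - l)%:C%C *: c.
have dE z : d z = rscale l (a z) + rscale (1 - l) (c z) by [].
have Mla := vnaZ hM l%:C%C Ma; have Mlc := vnaZ hM (1 - l)%:C%C Mc.
exists d.
  apply: unit_interval_intro => //; first exact: (vnaD hM).
    by apply: saD; exact: saZ.
  move=> z; rewrite dE ipDl !ipZl.
  have /andP[h1 h2] := a01 z; have /andP[h3 h4] := c01 z.
  have h5 : 0 <= l * (ip z z - ip (a z) z) by rewrite mulr_ge0 ?subr_ge0.
  have h6 : 0 <= (1 - l) * (ip z z - ip (c z) z) by rewrite mulr_ge0 ?subr_ge0.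
  apply/andP; split; last by lra.
  by rewrite addr_ge0 // mulr_ge0 // subr_ge0.
apply/rowP => j.
have -> : (l *: Psi a + (1 - l) *: Psi c) 0 j = l * Psi a 0 j + (1 - l) * Psi c 0 j.
  by rewrite mxE (mxE _ _ 0 j) [X in _ + X]mxE.
case: (split_ordP j) => i ->.
  by rewrite (ord1 i) !Psi_left (trD htau Mla Mlc) !(trZ hM htau).
rewrite !Psi_right.
have Mba : M (b i \o a) by exact: (vna_comp hM).
have Mbc : M (b i \o c) by exact: (vna_comp hM).
have -> : b i \o d = l%:C%C *: (b i \o a) + (1 - l)%:C%C *: (b i \o c).
  apply/funext => z; rewrite -[LHS]/(b i (rscale l (a z) + rscale (1 - l) (c z))).
  by rewrite (linD (vna_lin hM (hbM i))) !(linR (vna_lin hM (hbM i))).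
have := trD htau (vnaZ hM l%:C%C Mba) (vnaZ hM (1 - l)%:C%C Mbc).
by rewrite !(trZ hM htau).
Qed.

Local Notation pm s t := (proj_lt dot b s t).
Local Notation pp s t := (proj_le dot b s t).

(** The interval is where the functional with coefficients (- s, t) is minimal. *)
Lemma interval_face s t :
  Psi @` op_interval dot M (pm s t) (pp s t) =
  B `&` hyperplane (row_mx (\row_(_ < 1) (- s)) t)
    (tr (shifted (lincomb b t) s \o pm s t)).
Proof.
have Mb := lincomb_in_vna t; have sb := lincomb_sa t.
apply/seteqP; split=> [_ [a ia <-]|_ [[a ua <-] e]].
  have [ua _ _] := ia; have [Ma _ _] := ua.
  split; first by exists a.
  apply: etrans (pairing_Psi s t Ma) _.
  exact/(interval_min_eq hdot hM htau s Mb sb ua).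
have [Ma _ _] := ua; exists a => //.
apply/(interval_min_eq hdot hM htau s Mb sb ua).
by rewrite -(pairing_Psi s t Ma).
Qed.

Lemma interval_exposed s t : t != 0 ->
  exposed_face B (Psi @` op_interval dot M (pm s t) (pp s t)).
Proof.
move=> t0; have Mb := lincomb_in_vna t; have sb := lincomb_sa t.
have im : op_interval dot M (pm s t) (pp s t) (pm s t).
  exact: (lower_in_interval hdot hM htau s Mb sb).
have [um _ _] := im; have [Mm _ _] := um.
rewrite interval_face; apply: (minimum_exposed (x0 := Psi (pm s t))).
- exact: scale_convex.
- by rewrite row_mx_eq0 negb_and t0 orbT.
- move=> _ [a ua <-]; have [Ma _ _] := ua; rewrite pairing_Psi //.
  exact: (interval_min hdot hM htau s Mb sb ua).
- by exists (pm s t).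
- by rewrite pairing_Psi.
Qed.

End Scale.

(** * Classification of the exposed faces *)

Section Classification.
Variables (R : realType) (H : completeNormedModType R[i]).
Variable dot : {dot H for Num.conj}.
Hypothesis hdot : hilbert_dot dot.
Local Notation ip := (real_dot dot).
Variable M : set (H -> H).
Hypothesis hM : von_neumann_algebra dot M.
Variable tau : (H -> H) -> R[i].
Hypothesis htau : faithful_normal_tracial_state dot M tau.
Local Notation tr := (tr tau).
Variables (n : nat) (b : 'I_n -> H -> H).
Hypotheses (hbM : forall i, M (b i)) (hbsa : forall i, self_adjoint dot (b i)).
Local Notation B := (spectral_scale dot M tau b).
Local Notation Psi := (Psi tau b).
Local Notation pm s t := (proj_lt dot b s t).
Local Notation pp s t := (proj_le dot b s t).

Lemma interval_single s t : pm s t = pp s t ->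
  Psi @` op_interval dot M (pm s t) (pp s t) = [set Psi (pp s t)].
Proof.
move=> e; have Mb := lincomb_in_vna hM htau hbM t; have sb := lincomb_sa hbsa t.
apply/seteqP; split=> [_ [a ia <-]|_ ->] /=.
  by rewrite (interval_eq hdot hM Mb sb e ia).
by exists (pp s t) => //; exact: (upper_in_interval hdot hM s Mb sb).
Qed.

(** The first coordinate of Psi is the trace, which separates m from p. *)
Lemma interval_point s t x :
  Psi @` op_interval dot M (pm s t) (pp s t) = [set x] ->
  [/\ pm s t = pp s t, x = Psi (pm s t) & x = Psi (pp s t)].
Proof.
move=> e; have Mb := lincomb_in_vna hM htau hbM t; have sb := lincomb_sa hbsa t.
have em : Psi (pm s t) = x.
  suff : [set x] (Psi (pm s t)) by [].
  by rewrite -e; exists (pm s t) => //; exact: (lower_in_interval hdot hM htau s Mb sb).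
have ep : Psi (pp s t) = x.
  suff : [set x] (Psi (pp s t)) by [].
  by rewrite -e; exists (pp s t) => //; exact: (upper_in_interval hdot hM s Mb sb).
split=> //; apply: (tr_eq_interval hdot hM htau Mb sb).
by have := congr1 (fun y : 'rV_(1 + n) => y 0 (lshift n 0)) (etrans em (esym ep));
  rewrite !Psi_left.
Qed.

Lemma tr_unit_interval a : unit_interval dot M a ->
  (tr a <= 0 -> a = 0) /\ (1 <= tr a -> a = idfun).
Proof.
move=> ua; have [Ma la sa a01] := unit_interval_facts hM ua.
have [Mc _ sc c01] := unit_interval_facts hM (unit_interval_compl hM ua).
have [|h1 h2] := tr_psd htau Ma sa; first by move=> x; have /andP[] := a01 x.
have [|] := tr_psd htau Mc sc; first by move=> x; have /andP[] := c01 x.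
rewrite (trB hM htau (vna_one hM) Ma) (tr1 htau) => h3 h4.
split=> // ge1; have /eqP := h4 ltac:(lra).
by rewrite subr_eq0 => /eqP.
Qed.

(** Cuts outside of the bounds of the form of b_t are trivial. *)
Lemma extreme_spectral_projections t : exists L,
  (forall s, s < - L -> pm s t = 0 /\ pp s t = 0) /\
  (forall s, L < s -> pm s t = idfun /\ pp s t = idfun).
Proof.
have Mb := lincomb_in_vna hM htau hbM t; have sb := lincomb_sa hbsa t.
have [L L0 bL] := op_form_bound hdot (vna_bounded hM Mb).
have bL' x : `|ip ((- lincomb b t) x) x| <= L * ip x x.
  by rewrite -[(- _) x]/(- lincomb b t x) ipNl normrN.
exists L; split=> s sL.
  have p0 : pp s t = 0.
    by apply/funext => x; exact: (cut_bot hdot (upper_cut hdot hM s Mb sb) bL sL).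
  split=> //; apply/funext => x.
  rewrite /proj_lt -(lower_upper hdot hM s Mb sb) -/(proj_le _ _ _ _) p0.
  exact: lin0 (proj_lin (lower_proj hdot hM s Mb sb)).
have p1 : pp s t = idfun.
  apply/funext => x.
  exact: (cut_top hdot (upper_cut hdot hM s Mb sb) bL (ltW sL)).
split=> //; apply/funext => x.
have /eqP := cut_bot hdot (lower_cut hdot hM s Mb sb) bL' ltac:(by rewrite ltrN2) x.
by rewrite subr_eq0 => /eqP.
Qed.

(** A supporting functional with nonzero component t minimizes the trace of
    (b_t - s) a.  Otherwise it only sees the trace, and the face is the vertex
    Psi 0 or Psi 1, which any nonzero t yields for s outside of the spectrum. *)
Lemma exposed_interval F : (0 < n)%N -> exposed_face B F ->
  exists s t, t != 0 /\ F = Psi @` op_interval dot M (pm s t) (pp s t).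
Proof.
move=> n0 /exposed_faceP[[x0 Fx0] [c [al [c0 min FE]]]].
pose r := c 0 (lshift n 0); pose t := rsubmx c.
have cE : c = row_mx (\row_(_ < 1) r) t.
  rewrite -[c in LHS]hsubmxK; congr row_mx.
  by apply/rowP => i; rewrite !mxE (ord1 i).
have [B0 x0al] : B x0 /\ hyperplane c al x0 by rewrite FE in Fx0.
have [a0 ua0 a0x] := B0.
have [tz|t0] := eqVneq t 0; last first.
  exists (- r), t; split=> //.
  have Mb := lincomb_in_vna hM htau hbM t; have sb := lincomb_sa hbsa t.
  rewrite (interval_face hdot hM htau hbM hbsa) opprK -cE FE.
  congr (_ `&` hyperplane _ _).
  have pE a : M a -> pairing c (Psi a) = tr (shifted (lincomb b t) (- r) \o a).
    by move=> Ma; rewrite -(pairing_Psi hM htau hbM) // opprK -cE.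
  have [um _ _] := lower_in_interval hdot hM htau (- r) Mb sb.
  have [Mm _ _] := um; have [Ma0 _ _] := ua0.
  have h1 : al <= tr (shifted (lincomb b t) (- r) \o pm (- r) t).
    by rewrite -pE //; apply: min; exists (pm (- r) t).
  have h2 := interval_min hdot hM htau (- r) Mb sb ua0.
  have h3 : tr (shifted (lincomb b t) (- r) \o a0) = al.
    by rewrite -pE // a0x; exact: x0al.
  by apply/eqP; rewrite eq_le h1 -h3.
have r0 : r != 0.
  apply: contra c0 => /eqP r0; rewrite cE tz r0 row_mx_eq0 eqxx andbT.
  by apply/eqP/rowP => i; rewrite !mxE.
have pE a : M a -> pairing c (Psi a) = r * tr a.
  move=> Ma; rewrite cE (pairing_Psi_row hM htau hbM) // tz.
  have -> : lincomb b 0 = 0.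
    by rewrite /lincomb big1 // => i _; rewrite mxE rmorph0 scale0r.
  have -> : (0 : H -> H) \o a = 0 by [].
  by rewrite (tr0 hM htau) add0r.
pose t1 : 'rV[R]_n := const_mx 1.
have t10 : t1 != 0.
  apply/eqP => /rowP/(_ (Ordinal n0)); rewrite !mxE => /eqP.
  by rewrite oner_eq0.
have [L [low high]] := extreme_spectral_projections t1.
have [Ma0 _ _] := ua0; have [tr_0 tr_1] := tr_unit_interval ua0.
have a0al : r * tr a0 = al by rewrite -pE // a0x; exact: x0al.
have u0 : unit_interval dot M 0.
  exact: (proj_unit_interval hdot (proj0 hdot) (vna0 hM)).
have u1 : unit_interval dot M idfun.
  exact: (proj_unit_interval hdot (proj1 hdot) (vna_one hM)).
have single (z : H -> H) : a0 = z ->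
    (forall a, unit_interval dot M a -> r * tr a = al -> a = z) -> F = [set Psi z].
  move=> a0z uniq; rewrite FE; apply/seteqP; split=> [_ [[a ua <-] e]|_ ->] /=.
    have [Ma _ _] := ua; rewrite (uniq a) // -pE //; exact: e.
  by split; rewrite -a0z ?a0x.
have al0 : al <= 0.
  have := min (Psi 0) ltac:(by exists 0); rewrite pE; last exact: (vna0 hM).
  by rewrite (tr0 hM htau) mulr0.
have al1 : al <= r.
  have := min (Psi idfun) ltac:(by exists idfun); rewrite pE; last exact: (vna_one hM).
  by rewrite (tr1 htau) mulr1.
have [rneg|rpos|rz] := ltgtP r 0; last by rewrite rz eqxx in r0.
  exists (L + 1), t1; split=> //; have [e1 e2] := high (L + 1) ltac:(by rewrite ltrDl).
  rewrite interval_single; last by rewrite e1 e2.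
  rewrite e2; have big a : r * tr a = al -> 1 <= tr a.
    by move=> e; rewrite -(ler_nM2l rneg) mulr1 e.
  apply: single => [|a ua /big]; first exact: tr_1 (big _ a0al).
  by have [_ h] := tr_unit_interval ua.
exists (- (L + 1)), t1; split=> //.
have [e1 e2] := low (- (L + 1)) ltac:(by rewrite ltrN2 ltrDl).
rewrite interval_single; last by rewrite e1 e2.
rewrite e2; have small a : r * tr a = al -> tr a <= 0.
  by move=> e; rewrite -(ler_pM2l rpos) mulr0 e.
apply: single => [|a ua /small]; first exact: tr_0 (small _ a0al).
by have [h _] := tr_unit_interval ua.
Qed.

End Classification.

Lemma singleton_face_extreme (R : realType) (N : nat) (C : set 'rV[R]_N) x :
  is_face C [set x] -> extreme_point C x.
Proof.
move=> [sub _ fc]; split; first exact: sub.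
by move=> y z l Cy Cz l01 xE; apply: (fc y z l).
Qed.

Theorem corollary0p3 (R : realType) (H : completeNormedModType R[i])
    (dot : {dot H for Num.conj}) (hdot : hilbert_dot dot)
    (M : set (H -> H)) (hM : von_neumann_algebra dot M)
    (hfin : finite_vna dot M)
    (tau : (H -> H) -> R[i]) (htau : faithful_normal_tracial_state dot M tau)
    (n : nat) (hn : (0 < n)%N) (b : 'I_n -> H -> H)
    (hbM : forall i, M (b i)) (hbsa : forall i, self_adjoint dot (b i)) :
  let B := spectral_scale dot M tau b in
  let Psi := Psi tau b in
  let pm := proj_lt dot b in
  let pp := proj_le dot b in
  [/\ forall F : set 'rV[R]_(1 + n),
        exposed_face B F <->
        exists s t, spectral_pair s t /\
          F = Psi @` op_interval dot M (pm s t) (pp s t),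
      forall x : 'rV[R]_(1 + n), extreme_point B x ->
        (exposed_point B x <->
         exists s t, [/\ spectral_pair s t, pm s t = pp s t,
           x = Psi (pm s t) & x = Psi (pp s t)])
    & forall F : set 'rV[R]_(1 + n), is_face B F ->
        ~ (exists x, extreme_point B x /\ F = [set x]) ->
        (exposed_face B F <->
         exists s t, [/\ spectral_pair s t,
           F = Psi @` op_interval dot M (pm s t) (pp s t)
           & is_eigenvalue s (lincomb b t)]) /\
        (forall s t, spectral_pair s t ->
           F = Psi @` op_interval dot M (pm s t) (pp s t) ->
           is_eigenvalue s (lincomb b t) ->
           pp s t - pm s t <> 0 /\
           lincomb b t \o (pp s t - pm s t) = s%:C%C *: (pp s t - pm s t))].
Proof.
move=> B Psi pm pp.
have part1 F : exposed_face B F <-> exists s t, spectral_pair s t /\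
    F = Psi @` op_interval dot M (pm s t) (pp s t).
  split=> [/(exposed_interval hdot hM htau hbM hbsa hn)//|[s [t [t0 ->]]]].
  exact: (interval_exposed hdot hM htau hbM hbsa).
have Mb t := lincomb_in_vna hM htau hbM t; have sb t := lincomb_sa hbsa t.
split=> [//|x _|F fF nF].
  split=> [/part1[s [t [t0 e]]]|[s [t [t0 e _ xp]]]].
    have [h1 h2 h3] := interval_point hdot hM htau hbM hbsa (esym e).
    by exists s, t.
  apply/part1; exists s, t; split=> //.
  by rewrite (interval_single hdot hM htau hbM hbsa e) xp.
split.
  split=> [/part1[s [t [t0 FE]]]|[s [t [t0 FE _]]]]; last first.
    by apply/part1; exists s, t.
  exists s, t; split=> //; apply/(eigenvalue_diff hdot hM s (Mb t) (sb t)) => e.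
  apply: nF; exists (Psi (pp s t)).
  have FS : F = [set Psi (pp s t)].
    by rewrite FE; exact: (interval_single hdot hM htau hbM hbsa e).
  by split=> //; apply: singleton_face_extreme; rewrite -FS.
move=> s t t0 FE ev; split; last exact: (eigen_diff hdot hM s (Mb t) (sb t)).
move/eqP; rewrite subr_eq0 => /eqP e.
by have /(eigenvalue_diff hdot hM s (Mb t) (sb t)) := ev; apply; exact: (esym e).
Qed.
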